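(* Let $E$ be a symmetric space on $I=[0,\alpha)$ (with the Fatou property), where $\alpha=1$ or $\alpha=\infty$, with fundamental function $\phi$, and let $x\in E$. Then the following conditions are equivalent. (i) $x$ is a point of order continuity of $E$ and, in case $\alpha=\infty$, $\phi(s)x^{**}(s)\to0$ as $s\to\infty$. (ii) $x$ is a point of $K$-order continuity of $E$ and, in case $\alpha=\infty$, $x^*(\infty)=0$.
   Context: Let $\mu$ be Lebesgue measure on $I=[0,\alpha)$, where $\alpha=1$ or $\alpha=\infty$, and let $L^0$ be the set of (equivalence classes of) extended real valued Lebesgue measurable functions on $I$. A Banach function space $E$ is a Banach lattice $(E,\|\cdot\|_E)$ which is a sublattice of $L^0$ such that: (1) if $x\in L^0$, $y\in E$ and $|x|\le|y|$ a.e., then $x\in E$ and $\|x\|_E\le\|y\|_E$; (2) there exists a strictly positive $x\in E$. $E^+=\{x\in E: x\ge 0\}$. $E$ has the Fatou property if whenever $(x_n)\subset E^+$, $\sup_n\|x_n\|_E<\infty$ and $x_n\uparrow x\in L^0$, then $x\in E$ and $\|x_n\|_E\uparrow\|x\|_E$. Standing assumption: $E$ has the Fatou property. For $x\in L^0$: the distribution function is $d_x(\lambda)=\mu\{s\in I:|x(s)|>\lambda\}$, $\lambda\ge0$; the decreasing rearrangement is $x^*(t)=\inf\{\lambda>0:d_x(\lambda)\le t\}$, $t\ge0$; the maximal function is $x^{**}(t)=\frac1t\int_0^t x^*(s)\,ds$, $t>0$. Convention: $x^*(\infty)=\lim_{t\to\infty}x^*(t)$ if $\alpha=\infty$, and $x^*(\infty)=0$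 if $\alpha=1$. A Banach function space $E$ is symmetric if whenever $x\in L^0$, $y\in E$ and $d_x=d_y$, then $x\in E$ and $\|x\|_E=\|y\|_E$. Its fundamental function is $\phi(t)=\|\chi_{(0,t)}\|_E$, $t\in[0,\alpha)$. For $x,y\in L^1+L^\infty$, $x\prec y$ iff $x^{**}(t)\le y^{**}(t)$ for all $t>0$. $x\in E$ is a point of order continuity of $E$ if for every sequence $(x_n)\subset E^+$ with $x_n\le|x|$ and $x_n\to0$ a.e. we have $\|x_n\|_E\to0$. $x\in E$ is a point of $K$-order continuity of $E$ if for every sequence $(x_n)\subset E$ with $x_n\prec x$ for all $n$ and $x_n^*\to0$ a.e. we have $\|x_n\|_E\to0$. *)

(* Defs.v *)
From HB Require Import structures.
From mathcomp Require Import all_boot all_order all_algebra.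
From mathcomp Require Import all_classical all_reals all_analysis.
From mathcomp Require Import measurable_realfun.
Set Implicit Arguments.
Unset Strict Implicit.
Unset Printing Implicit Defensive.
Import Order.TTheory GRing.Theory Num.Theory.
Import numFieldNormedType.Exports.
Local Open Scope classical_set_scope.
Local Open Scope ring_scope.
Local Open Scope ereal_scope.

(* Elements of L^0 are represented by functions R -> \bar R of which only the
   values on I = [0, alpha) matter, and two functions that agree a.e. on I
   represent the same element.  [measurable_fun] is Borel measurability: since
   every Lebesgue measurable function is a.e. equal to a Borel one, the
   classes are the same as with Lebesgue measurability. *)

Definition base {R : realType} (alpha : \bar R) : set R :=
  [set t : R | (0 <= t)%R /\ t%:E < alpha].

Definition ae_base {R : realType} (alpha : \bar R) (P : R -> Prop) : Prop :=
  {ae (@lebesgue_measure R), forall t : R, base alpha t -> P t}.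

Definition L0 {R : realType} (alpha : \bar R) (x : R -> \bar R) : Prop :=
  measurable_fun (base alpha) x.

Section Rearrangement.
Context {R : realType} (alpha : \bar R).
Implicit Types x y : R -> \bar R.

Definition distr_fun x (l : R) : \bar R :=
  lebesgue_measure (base alpha `&` [set s | l%:E < `|x s|]).

Definition decr_rearr x (t : R) : \bar R :=
  ereal_inf [set l%:E | l in [set l : R | (0 < l)%R /\ distr_fun x l <= t%:E]].

Definition max_fun x (t : R) : \bar R :=
  (t^-1)%:E * \int[lebesgue_measure]_(s in `[0%R, t]) decr_rearr x s.

Definition decr_rearr_infty x : \bar R :=
  if alpha == +oo then lim (decr_rearr x t @[t --> +oo%R]) else 0.

Definition L1_plus_Linfty x : Prop :=
  L0 alpha x /\
  exists f g : R -> \bar R,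
    [/\ (@lebesgue_measure R).-integrable (base alpha) f,
        L0 alpha g,
        exists M : R, ae_base alpha (fun t => `|g t| <= M%:E)
      & ae_base alpha (fun t => x t = f t + g t)].

Definition hlp_prec x y : Prop :=
  [/\ L1_plus_Linfty x, L1_plus_Linfty y
    & forall t : R, (0 < t)%R -> max_fun x t <= max_fun y t].

End Rearrangement.

Section FunctionSpaces.
Context {R : realType} (alpha : \bar R).
(* A space is given by the set E of the functions representing its elements
   and by its norm, whose values outside E are irrelevant. *)
Variables (E : set (R -> \bar R)) (nrm : (R -> \bar R) -> R).

(* Invariance of E and of the norm under a.e. equality on I follows from
   [bfs_ideal].  Homogeneity and definiteness force the elements of E to be
   a.e. finite on I, so the values of the sum at points where it reads
   +oo - oo do not matter. *)
Record banach_function_space : Prop := {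
  bfs_L0 : forall x, E x -> L0 alpha x;
  bfs_zero : E (cst 0);
  bfs_add : forall x y, E x -> E y -> E (fun t => x t + y t);
  bfs_scale : forall (c : R) x, E x -> E (fun t => c%:E * x t);
  bfs_sup : forall x y, E x -> E y -> E (fun t => maxe (x t) (y t));
  bfs_inf : forall x y, E x -> E y -> E (fun t => mine (x t) (y t));
  bfs_norm_ge0 : forall x, E x -> (0 <= nrm x)%R;
  bfs_norm_eq0 : forall x, E x -> nrm x = 0%R ->
    ae_base alpha (fun t => x t = 0);
  bfs_norm_scale : forall (c : R) x, E x ->
    nrm (fun t => c%:E * x t) = (`|c| * nrm x)%R;
  bfs_norm_triangle : forall x y, E x -> E y ->
    (nrm (fun t => x t + y t)%E <= nrm x + nrm y)%R;
  bfs_complete : forall u : nat -> (R -> \bar R), (forall n, E (u n)) ->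
    (forall e : R, (0 < e)%R -> exists K : nat, forall m n : nat,
        (K <= m)%N -> (K <= n)%N -> (nrm (fun t => u m t - u n t)%E < e)%R) ->
    exists2 x, E x & nrm (fun t => u n t - x t)%E @[n --> \oo] --> (0 : R)%R;
  bfs_ideal : forall x y, L0 alpha x -> E y ->
    ae_base alpha (fun t => `|x t| <= `|y t|) -> E x /\ (nrm x <= nrm y)%R;
  bfs_pos : exists2 x, E x & ae_base alpha (fun t => 0 < x t)
}.

Record symmetric_space : Prop := {
  sym_bfs : banach_function_space;
  sym_distr : forall x y, L0 alpha x -> E y ->
    (forall l : R, (0 <= l)%R -> distr_fun alpha x l = distr_fun alpha y l) ->
    E x /\ nrm x = nrm y
}.

Definition pos_cone : set (R -> \bar R) :=
  [set x | E x /\ ae_base alpha (fun t => 0 <= x t)].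

Definition fatou_property : Prop :=
  forall (u : nat -> (R -> \bar R)) (x : R -> \bar R),
    (forall n, pos_cone (u n)) ->
    has_ubound (range (fun n => nrm (u n))) ->
    L0 alpha x ->
    (forall n, ae_base alpha (fun t => u n t <= u n.+1 t)) ->
    ae_base alpha (fun t => u n t @[n --> \oo] --> x t) ->
    [/\ E x, nondecreasing_seq (fun n => nrm (u n))
      & nrm (u n) @[n --> \oo] --> nrm x].

Definition fundamental_fun (t : R) : R :=
  nrm (fun s => (\1_(`]0%R, t[ : set R) s)%:E).

Definition order_continuity_point (x : R -> \bar R) : Prop :=
  E x /\
  forall u : nat -> (R -> \bar R),
    (forall n, pos_cone (u n)) ->
    (forall n, ae_base alpha (fun t => u n t <= `|x t|)) ->
    ae_base alpha (fun t => u n t @[n --> \oo] --> (0 : \bar R)) ->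
    nrm (u n) @[n --> \oo] --> (0 : R)%R.

Definition K_order_continuity_point (x : R -> \bar R) : Prop :=
  E x /\
  forall u : nat -> (R -> \bar R),
    (forall n, E (u n)) ->
    (forall n, hlp_prec alpha (u n) x) ->
    ae_base alpha
      (fun t => decr_rearr alpha (u n) t @[n --> \oo] --> (0 : \bar R)) ->
    nrm (u n) @[n --> \oo] --> (0 : R)%R.

End FunctionSpaces.

(* Main.v *)
(** The rearrangement x^* is equimeasurable with |x|, so all norms can be computed on
    nonincreasing functions.  The engine is the fact that, for nonincreasing f and g, an
    inequality of the primitives of f and g yields ||f|| <= 2 ||g||: on a grid, a vector
    majorized by another one is reached from it by transfers, each of which is a convex
    combination of the vector and a transposition of it, and the Fatou property passes to
    the limit.

    (i) => (ii): if u is majorized by x, then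
      u^* <= u^* chi_[0,d) + u^*(d) chi_(0,T) + min (u^*, u^*(T)),
    where the first term is majorized by x^* chi_[0,d) and the last one by
    x^** (T) chi_[0,T) + x^* chi_[T,oo).  Order continuity of x makes the norms of
    (|x| - n)^+ and min (|x|, 1/n) and the values of phi near 0 small, hence both majorants
    small for small d and large T, while u_n^*(d) phi(T) tends to 0.

    (ii) => (i): if 0 <= u_n <= |x| and u_n -> 0 a.e., then x^*(oo) = 0 gives convergence
    in measure, that is u_n^* -> 0; and x^**(s) chi_(0,s) is majorized by x, with norm
    phi(s) x^**(s) and with values tending to 0. *)
Require Import Defs.
From HB Require Import structures.
From mathcomp Require Import all_boot all_order all_algebra.
From mathcomp Require Import all_classical all_reals all_analysis.
From mathcomp Require Import measurable_realfun.
From mathcomp Require Import perm ring lra.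
Set Implicit Arguments.
Unset Strict Implicit.
Unset Printing Implicit Defensive.
Import Order.TTheory GRing.Theory Num.Theory.
Import numFieldNormedType.Exports.
Local Open Scope classical_set_scope.
Local Open Scope ring_scope.
Local Open Scope ereal_scope.

(** The relation [hlp_prec] compares primitives, while a symmetric norm is only known to respect
    pointwise domination and equimeasurability. Vectors on a grid of equal cells bridge the gap,
    because permuting cells is an equimeasurable change.

    A rearrangement may be infinite at [0], so an upper step function of [g] need not exist. Its
    first value is therefore replaced by the mean of [g] over the first cell, whose norm is
    estimated separately. This extra term is the origin of the factor 2, which is harmless since
    norms only have to be made small.

    In (i) => (ii), cutting [u^*] off to the left of [T] would destroy monotonicity; this is why the
    tail is represented by [min (u^*, u^*(T))], and why its majorant needs the height [x^**(T)] on
    [[0,T)]. Smallness of phi near 0 is no assumption: it follows from order continuity at a nonzero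
    [x], while [x = 0] is treated apart. That [x^*(oo) = 0] follows from
    [phi(1) x^*(T) <= phi(T) x^**(T)] for [T >= 1]. *)

Section monotone_functions.
Context {R : realType}.
Local Notation mu := (@lebesgue_measure R).
Implicit Types (f g : R -> \bar R) (c : \bar R).

(** * Initial intervals and monotone functions *)

Lemma exists_natSinv_lt (e : R) : (0 < e)%R -> exists n, (n.+1%:R^-1 < e)%R.
Proof.
move=> e0; have [n _ /(_ n (leqnn _))] := near_infty_natSinv_lt (PosNum e0).
by exists n.
Qed.

Lemma base_measurable c : measurable (@base R c).
Proof.
apply: is_interval_measurable => s t [s0 sc] [t0 tc] r /andP[sr rt]; split.
  exact: le_trans sr.
by apply: le_lt_trans tc; rewrite lee_fin.
Qed.

Lemma base_fin (r : R) : base r%:E = `[0%R, r[%classic.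
Proof. by apply/seteqP; split => t; rewrite /base/= in_itv/= lte_fin => /andP. Qed.

Lemma base_pinfty : @base R +oo = `[0%R, +oo[%classic.
Proof.
apply/seteqP; split => t; rewrite /base/= in_itv/= andbT; first by case.
by move=> ->; rewrite ltry.
Qed.

(** Applied not only to [alpha] but also to values of distribution functions: [base c] is then the
    interval [[0, c)], with [c] possibly infinite. *)
Lemma measure_base c : 0 <= c -> mu (base c) = c.
Proof.
case: c => [r||] //; last by rewrite base_pinfty lebesgue_measure_itv/= ltry.
rewrite lee_fin base_fin lebesgue_measure_itv/= lte_fin le_eqVlt.
by move=> /predU1P[<-|->]; rewrite ?ltxx ?oppr0 ?adde0.
Qed.

Lemma nonincreasing_emeasurable (f : R -> \bar R) :
  {homo f : s t / (s <= t)%R >-> t <= s} -> measurable_fun [set: R] f.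
Proof.
move=> mf.
apply: (measurability _ (ErealGenOInfty.measurableE R)) => _ [_ [r ->]] <-.
rewrite setTI; apply: is_interval_measurable => s t.
rewrite /= !in_itv/= !andbT => rs rt u /andP[_ ut].
by rewrite in_itv/= andbT (lt_le_trans rt)// mf.
Qed.

End monotone_functions.

(** * Distribution function and decreasing rearrangement *)

Section rearrangement_theory.
Context {R : realType} (alpha : \bar R).
Local Notation mu := (@lebesgue_measure R).
Implicit Types (x y : R -> \bar R) (l t : R).
Local Notation "x ^*" := (decr_rearr alpha x).

Lemma measurable_level x l : L0 alpha x ->
  measurable (base alpha `&` [set s | l%:E < `|x s|]).
Proof.
move=> mx.
have mabs : measurable_fun (base alpha) (abse \o x).
  exact: measurableT_comp.
exact: emeasurable_fun_o_infty (base_measurable _) mabs _.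
Qed.

Lemma distr_fun_ge0 x l : 0 <= distr_fun alpha x l.
Proof. exact: measure_ge0. Qed.

Lemma distr_fun_nonincreasing x l l' : L0 alpha x -> (l <= l')%R ->
  distr_fun alpha x l' <= distr_fun alpha x l.
Proof.
move=> mx ll'; apply: le_measure; rewrite ?inE; try exact: measurable_level.
by move=> s [bs /= ls]; split => //=; apply: le_lt_trans ls; rewrite lee_fin.
Qed.

Lemma le_distr_fun x y l : L0 alpha x -> L0 alpha y ->
  ae_base alpha (fun t => `|x t| <= `|y t|) ->
  distr_fun alpha x l <= distr_fun alpha y l.
Proof.
move=> mx my [N [mN N0 xyN]]; rewrite /distr_fun.
rewrite -[leRHS]adde0 -[X in _ <= _ + X]N0.
have my' := measurable_level l my.
apply: le_trans (measureU2 mu my' mN).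
apply: le_measure; rewrite ?inE.
- exact: measurable_level.
- by apply: measurableU => //; exact: measurable_level.
- move=> s [bs /= ls]; have [Ns|Ns] := pselect (N s); [by right|left].
  split => //=; apply: (lt_le_trans ls).
  by move: bs; apply: contrapT => sxy; apply: Ns; apply: xyN.
Qed.

(** The level set at [l] is the increasing union of those at [l + 1/(n+1)]; continuity from below
    holds for infinite measures too. *)
Lemma distr_fun_right_continuous x l (c : \bar R) : L0 alpha x ->
  c < distr_fun alpha x l -> exists2 l', (l < l')%R & c < distr_fun alpha x l'.
Proof.
move=> mx cd; apply: contrapT => H.
have Hle l' : (l < l')%R -> distr_fun alpha x l' <= c.
  by move=> ll'; rewrite leNgt; apply/negP => ?; apply: H; exists l'.
pose F n := base alpha `&` [set s | (l + n.+1%:R^-1)%:E < `|x s|].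
have mF n : measurable (F n) by exact: measurable_level.
have UF : \bigcup_n F n = base alpha `&` [set s | l%:E < `|x s|].
  apply/seteqP; split=> [s [n _ [bs /= ls]]|s [bs /= ls]].
    by split => //=; apply: le_lt_trans ls; rewrite lee_fin lerDl.
  have [n ln] : exists n, (l + n.+1%:R^-1)%:E < `|x s|.
    case: (`|x s|) ls => [r||]//; last by exists 0%N; rewrite ltry.
    rewrite lte_fin -subr_gt0 => /exists_natSinv_lt[n nr]; exists n.
    by rewrite lte_fin -ltrBrDl.
  by exists n.
have ndF : {homo F : n m / (n <= m)%N >-> (n <= m)%O}.
  move=> n m nm; apply/subsetPset => s [bs /= ls]; split => //=.
  apply: le_lt_trans ls; rewrite lee_fin lerD2l lef_pV2 ?posrE//.
  by rewrite ler_nat.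
have mUF : measurable (\bigcup_n F n) by rewrite UF; exact: measurable_level.
have FU := nondecreasing_cvg_mu mF mUF ndF (mu := mu).
suff : mu (\bigcup_n F n) <= c by rewrite UF leNgt cd.
rewrite -(cvg_lim _ FU)//; apply: lime_le; first by apply/cvg_ex; eexists; exact: FU.
by apply: nearW => n; apply: Hle; rewrite ltrDl.
Qed.

(** Right continuity of the distribution function makes [x^*] its exact generalized inverse. Level
    sets of [x^*] are computed through this equivalence. *)
Lemma lt_decr_rearr x l t : L0 alpha x -> (0 <= l)%R ->
  (l%:E < x^* t) = (t%:E < distr_fun alpha x l).
Proof.
move=> mx l0; apply/idP/idP; last first.
  move=> /(distr_fun_right_continuous mx)[l' ll' tl'].
  apply: (@lt_le_trans _ _ l'%:E); first by rewrite lte_fin.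
  apply: le_ereal_inf_tmp => _ [m [m0 mt] <-]; rewrite lee_fin leNgt.
  apply/negP => ml'; have := lt_le_trans tl' (distr_fun_nonincreasing mx (ltW ml')).
  by rewrite ltNge mt.
apply: contraTT; rewrite -!leNgt => dt; apply/lee_addgt0Pr => e e0.
apply: ereal_inf_lbound; exists (l + e)%R => //; split; first by rewrite ltr_wpDl.
by apply: le_trans dt; apply: distr_fun_nonincreasing => //; rewrite lerDl ltW.
Qed.

Lemma decr_rearr_ge0 x t : 0 <= x^* t.
Proof. by apply: le_ereal_inf_tmp => _ [m [m0 _] <-]; rewrite lee_fin ltW. Qed.

(** Monotonicity extends to the whole line because at negative arguments the infimum is over the
    empty set, hence [+oo]. *)
Lemma decr_rearr_nonincreasing x : {homo x^* : s t / (s <= t)%R >-> t <= s}.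
Proof.
move=> s t st; apply: le_ereal_inf => _ [m [m0 ms] <-]; exists m => //; split => //.
by apply: (le_trans ms); rewrite lee_fin.
Qed.

Lemma measurable_decr_rearr x : measurable_fun [set: R] x^*.
Proof. by apply: nonincreasing_emeasurable; exact: decr_rearr_nonincreasing. Qed.

Lemma L0_nonincreasing (f : R -> \bar R) :
  {homo f : s t / (s <= t)%R >-> t <= s} -> L0 alpha f.
Proof. by move=> mf; rewrite /L0; exact: (measurable_funTS (nonincreasing_emeasurable mf)). Qed.

(** By [lt_decr_rearr], the level set of [x^*] is the interval [[0, d)], where [d] is the measure of
    the level set of [x]; [d <= alpha] keeps it inside the base. *)
Lemma distr_decr_rearr x l : 0 <= alpha -> L0 alpha x -> (0 <= l)%R ->
  distr_fun alpha x^* l = distr_fun alpha x l.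
Proof.
move=> a0 mx l0; rewrite -[RHS]measure_base ?distr_fun_ge0//; congr (mu _).
have da : distr_fun alpha x l <= alpha.
  rewrite -[leRHS]measure_base//; apply: le_measure; rewrite ?inE.
  - exact: measurable_level.
  - exact: base_measurable.
  - by move=> ? [].
apply/seteqP; split=> [s [[s0 sa]]/=|s [s0 sd]].
  by rewrite gee0_abs ?decr_rearr_ge0// lt_decr_rearr.
split; first by split => //; apply: lt_le_trans da.
by rewrite /= gee0_abs ?decr_rearr_ge0// lt_decr_rearr.
Qed.

(** For a nonincreasing function this is right continuity; the strict inequality
    [t < distr_fun alpha x l] leaves room for a larger argument. *)
Lemma decr_rearr_right_continuous x t l : L0 alpha x -> l%:E < x^* t ->
  exists2 s, (t < s)%R & l%:E < x^* s.
Proof.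
move=> mx; have [l0|l0] := leP 0%R l; last first.
  move=> _; exists (t + 1)%R; rewrite ?ltrDl//.
  by apply: lt_le_trans (decr_rearr_ge0 _ _); rewrite lte_fin.
rewrite lt_decr_rearr//.
have [d|d|d] := ltgtP (distr_fun alpha x l) (+oo); last 2 first.
- by rewrite ltNge leey in d.
- move=> _; exists (t + 1)%R; first by rewrite ltrDl.
  by rewrite lt_decr_rearr// d ltry.
have df : distr_fun alpha x l \is a fin_num by rewrite ge0_fin_numE ?distr_fun_ge0.
rewrite -(fineK df) lte_fin => td.
exists ((t + fine (distr_fun alpha x l)) / 2)%R; first by rewrite midf_lt.
by rewrite lt_decr_rearr// -(fineK df) lte_fin midf_lt.
Qed.

Lemma decr_rearr_le x y t : L0 alpha x -> L0 alpha y ->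
  ae_base alpha (fun t => `|x t| <= `|y t|) -> x^* t <= y^* t.
Proof.
move=> mx my xy; apply: le_ereal_inf => _ [m [m0 mt] <-]; exists m => //; split => //.
by apply: le_trans mt; exact: le_distr_fun.
Qed.

End rearrangement_theory.

(** * Integrals of nonincreasing functions and Riemann sums *)

Section integrals_of_monotone_functions.
Context {R : realType}.
Local Notation mu := (@lebesgue_measure R).
Variable f : R -> \bar R.
Hypothesis f_ni : {homo f : s t / (s <= t)%R >-> t <= s}.
Hypothesis f_ge0 : forall t, 0 <= f t.

Let mf (D : set R) : measurable_fun D f.
Proof. exact: (measurable_funTS (nonincreasing_emeasurable f_ni)). Qed.

Lemma integral0_split (a b : R) : (0 <= a)%R -> (a <= b)%R ->
  \int[mu]_(s in `[0%R, b]) f s =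
  \int[mu]_(s in `[0%R, a]) f s + \int[mu]_(s in `]a, b]) f s.
Proof.
move=> a0 ab; rewrite -ge0_integral_setU//.
- by rewrite -itv_bndbnd_setU// bnd_simp.
- exact: mf.
- rewrite disj_set2E; apply/eqP/seteqP; split=> // s [/=].
  rewrite !in_itv/= => /andP[_ sa] /andP[].
  by rewrite ltNge sa.
Qed.

Lemma integral_oc_ge (a b : R) : (a <= b)%R ->
  (b - a)%:E * f b <= \int[mu]_(s in `]a, b]) f s.
Proof.
move=> ab.
have -> : (b - a)%:E * f b = \int[mu]_(s in `]a, b]) cst (f b) s.
  rewrite integral_cst//= lebesgue_measure_itv/= lte_fin muleC; congr (_ * _).
  by move: ab; rewrite le_eqVlt => /predU1P[->|->]; rewrite ?ltxx ?subrr.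
apply: ge0_le_integral => //=; first exact: mf.
by move=> s; rewrite in_itv/= => /andP[_ sb]; exact: f_ni.
Qed.

Lemma integral_oc_le (a b : R) : (a <= b)%R ->
  \int[mu]_(s in `]a, b]) f s <= (b - a)%:E * f a.
Proof.
move=> ab.
have -> : (b - a)%:E * f a = \int[mu]_(s in `]a, b]) cst (f a) s.
  rewrite integral_cst//= lebesgue_measure_itv/= lte_fin muleC; congr (_ * _).
  by move: ab; rewrite le_eqVlt => /predU1P[->|->]; rewrite ?ltxx ?subrr.
apply: ge0_le_integral => //=; first exact: mf.
by move=> s; rewrite in_itv/= => /andP[sa _]; apply: f_ni; exact: ltW.
Qed.

Lemma integral0_ge0 (t : R) : 0 <= \int[mu]_(s in `[0%R, t]) f s.
Proof. exact: integral_ge0. Qed.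

Lemma integral0_00 : \int[mu]_(s in `[0%R, 0%R]) f s = 0.
Proof. by rewrite set_itv1 integral_set1. Qed.

Lemma integral0_ge (t : R) : (0 <= t)%R ->
  t%:E * f t <= \int[mu]_(s in `[0%R, t]) f s.
Proof.
move=> t0; rewrite (integral0_split (lexx 0%R) t0) integral0_00 add0e.
by rewrite -[X in X%:E * _]subr0 integral_oc_ge.
Qed.

Lemma le_integral0 (s t : R) : (0 <= s)%R -> (s <= t)%R ->
  \int[mu]_(r in `[0%R, s]) f r <= \int[mu]_(r in `[0%R, t]) f r.
Proof.
by move=> s0 st; rewrite (integral0_split s0 st) leeDl// integral_ge0.
Qed.

(** On []s, t]] the function is at most [f s], which is at most its mean over [[0, s]]; so means
    decrease. Clearing denominators avoids dividing integrals that may be infinite. *)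
Lemma integral0_average_le (s t : R) : (0 <= s)%R -> (s <= t)%R ->
  s%:E * \int[mu]_(r in `[0%R, t]) f r <= t%:E * \int[mu]_(r in `[0%R, s]) f r.
Proof.
move=> s0 st; rewrite (integral0_split s0 st) ge0_muleDr ?integral_ge0//.
have -> : (t%:E = s%:E + (t - s)%:E)%E by rewrite -EFinD addrC subrK.
rewrite ge0_muleDl ?lee_fin ?subr_ge0//; apply: leeD => //.
apply: (@le_trans _ _ (s%:E * ((t - s)%:E * f s))).
  by apply: lee_wpmul2l; rewrite ?lee_fin// integral_oc_le.
rewrite muleCA; apply: lee_wpmul2l; rewrite ?lee_fin ?subr_ge0//.
exact: integral0_ge.
Qed.

Lemma sum_le_integral0 (r : R) n : (0 <= r)%R ->
  \sum_(k < n) r%:E * f (k.+1%:R * r)%R <= \int[mu]_(s in `[0%R, (n%:R * r)%R]) f s.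
Proof.
move=> r0; elim: n => [|n IH]; first by rewrite big_ord0 integral_ge0.
have nS : (n%:R * r <= n.+1%:R * r)%R by rewrite ler_wpM2r// ler_nat.
rewrite big_ord_recr/= (integral0_split _ nS) ?mulr_ge0//; apply: leeD => //.
apply: le_trans (integral_oc_ge nS).
by rewrite -mulrBl -natrB// subSnn mul1r.
Qed.

(** Each cell is bounded by the value at its left end. The first cell is left out because [f 0] may
    be infinite. *)
Lemma integral_le_sum (r : R) n : (0 <= r)%R ->
  \int[mu]_(s in `]r, (n.+1%:R * r)%R]) f s <= \sum_(k < n) r%:E * f (k.+1%:R * r)%R.
Proof.
move=> r0; elim: n => [|n IH].
  by rewrite mul1r set_itvoc0 integral_set0 big_ord0.
have nS : (n.+1%:R * r <= n.+2%:R * r)%R by rewrite ler_wpM2r// ler_nat.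
have rS : (r <= n.+1%:R * r)%R by rewrite ler_peMl// ler1n.
rewrite big_ord_recr/= (@itv_bndbnd_setU _ _ _ (BRight (n.+1%:R * r)%R)) ?bnd_simp//.
rewrite ge0_integral_setU//=; [|exact: mf|]; last first.
  rewrite disj_set2E; apply/eqP/seteqP; split=> // s [/=].
  by rewrite !in_itv/= => /andP[_ sa] /andP[]; rewrite ltNge sa.
apply: leeD => //; apply: (le_trans (integral_oc_le nS)).
by rewrite -mulrBl -natrB// subSnn mul1r.
Qed.

(** Monotone convergence recovers the whole interval from estimates that stay away from [0]. *)
Lemma integral0_le_limit (h : R) (c : \bar R) : (0 < h)%R ->
  (forall n, \int[mu]_(s in `](h / n.+1%:R)%R, h]) f s <= c) ->
  \int[mu]_(s in `[0%R, h]) f s <= c.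
Proof.
move=> h0 H.
pose F n := `](h / n.+1%:R)%R, h]%classic.
have UF : \bigcup_n F n = `]0%R, h]%classic.
  apply/seteqP; split => [s [n _]|s]; rewrite /F/= !in_itv/=.
    by move=> /andP[ns ->]; rewrite andbT (le_lt_trans _ ns)// divr_ge0// ltW.
  move=> /andP[s0 sh]; have [n ns] := exists_natSinv_lt (divr_gt0 s0 h0).
  by exists n => //; rewrite /F/= in_itv/= sh andbT mulrC -ltr_pdivlMr.
have ndF : {homo F : n m / (n <= m)%N >-> (n <= m)%O}.
  move=> n m nm; apply/subsetPset => s; rewrite /F/= !in_itv/= => /andP[ns ->].
  rewrite andbT (le_lt_trans _ ns)// ler_pM2l// lef_pV2 ?posrE//.
  by rewrite ler_nat.
rewrite -integral_itv_obnd_cbnd// -UF.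
have FU : \int[mu]_(s in F n) f s @[n --> \oo] --> \int[mu]_(s in \bigcup_n F n) f s.
  apply: ge0_nondecreasing_set_cvg_integral => // n; last exact: mf.
  exact: measurable_itv.
rewrite -(cvg_lim _ FU)//; apply: lime_le; first by apply/cvg_ex; eexists; exact: FU.
exact: nearW.
Qed.

End integrals_of_monotone_functions.

Lemma ae_baseW {R : realType} (alpha : \bar R) (P : R -> Prop) :
  (forall t, base alpha t -> P t) -> ae_base alpha P.
Proof. by move=> H; apply: aeW => t; exact: H. Qed.

Lemma indic_in {T : Type} {R : pzRingType} (A : set T) t :
  A t -> \1_A t = 1%R :> R.
Proof. by move=> At; rewrite indicE mem_set. Qed.

Lemma indic_notin {T : Type} {R : pzRingType} (A : set T) t :
  ~ A t -> \1_A t = 0%R :> R.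
Proof. by move=> At; rewrite indicE memNset. Qed.

Lemma distr_fun_indic {R : realType} (alpha : \bar R) (c l : R) (A : set R) :
  A `<=` base alpha -> (0 <= l)%R ->
  distr_fun alpha (fun t => c%:E * (\1_A t)%:E) l =
  if (l < `|c|)%R then lebesgue_measure A else 0.
Proof.
move=> Ab l0; rewrite /distr_fun; case: ifPn => lc.
  congr (lebesgue_measure _); apply/seteqP; split=> [s [_ /=]|s As].
    have [//|As] := pselect (A s).
    by rewrite indic_notin// mulr0 normr0 lte_fin ltNge l0.
  by split; [exact: Ab|rewrite /= indic_in// mulr1 lte_fin].
rewrite [X in lebesgue_measure X](_ : _ = set0) ?measure0//.
rewrite -subset0 => s [_ /=]; rewrite lte_fin normrM => ls.
move: lc; rewrite -leNgt => cl; move: ls; rewrite ltNge (le_trans _ cl)//.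
by rewrite ler_piMr// indicE; case: (_ \in _); rewrite ?normr1 ?normr0.
Qed.

Lemma L0_indic {R : realType} (alpha : \bar R) (c : \bar R) (A : set R) :
  measurable A -> L0 alpha (fun t => c * (\1_A t)%:E).
Proof.
move=> mA; apply: measurable_funeM.
by apply/measurable_EFinP; exact: measurable_indic.
Qed.

Lemma ae_eq0_levels {R : realType} (alpha : \bar R) (x : R -> \bar R) :
  L0 alpha x -> (forall n, distr_fun alpha x n.+1%:R^-1 = 0) ->
  ae_base alpha (fun t => x t = 0).
Proof.
move=> mx x0.
pose A n := base alpha `&` [set s | (n.+1%:R^-1)%:E < `|x s|].
have nA n : (@lebesgue_measure R).-negligible (A n).
  by apply/negligibleP; [exact: measurable_level|exact: x0].
apply: negligibleS (negligible_bigcup nA) => t /= H.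
have bt : base alpha t by apply: contrapT => bt; apply: H.
have : 0 < `|x t| by rewrite lt_neqAle abse_ge0 andbT eq_sym abse_eq0; apply/eqP => xt; exact: H.
case xtE : (`|x t|) => [r||]//.
  rewrite lte_fin => /exists_natSinv_lt[n nr]; exists n => //.
  by split => //=; rewrite xtE lte_fin.
by move=> _; exists 0%N => //; split => //=; rewrite xtE ltry.
Qed.

(** * First consequences of the axioms of a symmetric space *)

Section symmetric_spaces.
Context {R : realType} (alpha : \bar R).
Hypothesis halpha : alpha = 1%:E \/ alpha = +oo.
Variables (E : set (R -> \bar R)) (nrm : (R -> \bar R) -> R).
Hypothesis hE : symmetric_space alpha E nrm.
Local Notation mu := (@lebesgue_measure R).
Local Notation "x ^*" := (decr_rearr alpha x).
Implicit Types (x y : R -> \bar R) (r l : R).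

Let hB : banach_function_space alpha E nrm := sym_bfs hE.

Lemma alpha_gt0 : 0 < alpha.
Proof. by case: halpha => ->; rewrite ?ltry// lte_fin. Qed.

Let alpha_ge0 : 0 <= alpha := ltW alpha_gt0.

Lemma space_le x y : L0 alpha x -> E y ->
  (forall t, base alpha t -> `|x t| <= `|y t|) -> E x /\ (nrm x <= nrm y)%R.
Proof. by move=> mx Ey xy; apply: (bfs_ideal hB) => //; exact: ae_baseW. Qed.

Lemma norm_ge0 x : E x -> (0 <= nrm x)%R.
Proof. exact: (bfs_norm_ge0 hB). Qed.

Lemma space_decr_rearr x : E x -> E x^* /\ nrm x^* = nrm x.
Proof.
move=> Ex; have mx := bfs_L0 hB Ex; apply: (sym_distr hE) Ex _ => //.
  by apply: L0_nonincreasing; exact: decr_rearr_nonincreasing.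
by move=> l l0; apply: distr_decr_rearr => //; exact: mx.
Qed.

(** The function that is [+oo] where [x] is infinite and 0 elsewhere lies in [E] by the ideal
    property and equals its own double; homogeneity gives it norm 0, so it vanishes a.e. *)
Lemma space_ae_finite x : E x -> ae_base alpha (fun t => `|x t| < +oo).
Proof.
move=> Ex; have mx : L0 alpha x := bfs_L0 hB Ex.
pose A := base alpha `&` (abse \o x) @^-1` [set +oo].
have mabs : measurable_fun (base alpha) (abse \o x).
  exact: measurableT_comp.
have mA : measurable A by exact: mabs (base_measurable _) _ (emeasurable_set1 _).
pose y t : \bar R := +oo * (\1_A t)%:E.
have [Ey _] : E y /\ (nrm y <= nrm x)%R.
  apply: space_le => //; first exact: L0_indic.
  move=> t bt; rewrite /y; have [[_ /= ->]|At] := pselect (A t).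
    exact: leey.
  by rewrite indic_notin// mule0 abse0.
have y2 : (fun t => 2%:E * y t) = y.
  apply/funext => t; rewrite /y indicE; case: (_ \in _); rewrite ?mule1 ?mule0//.
  by rewrite mulry gtr0_sg ?mul1e.
have ny : nrm y = 0%R.
  have := bfs_norm_scale hB 2%R Ey; rewrite y2 ger0_norm// => H.
  by lra.
have [N [mN N0 HN]] := bfs_norm_eq0 hB Ey ny.
exists N; split => // t /= Ht; apply: HN => /= Hy; apply: Ht => bt.
rewrite ltey; apply/eqP => xt.
have At : A t by split.
by have := Hy bt; rewrite /y indic_in// mule1.
Qed.

Lemma indic_equimeasurable (A B : set R) : measurable A -> measurable B ->
  A `<=` base alpha -> B `<=` base alpha -> mu A = mu B ->
  E (fun t => (\1_A t)%:E) -> E (fun t => (\1_B t)%:E) /\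
  nrm (fun t => (\1_B t)%:E) = nrm (fun t => (\1_A t)%:E).
Proof.
move=> mA mB Ab Bb AB EA; apply: (sym_distr hE) EA _ => [|l l0].
  by apply/measurable_EFinP; exact: measurable_indic.
under eq_fun do rewrite -[(\1_B _)%:E]mul1e.
under [in RHS]eq_fun do rewrite -[(\1_A _)%:E]mul1e.
by rewrite !distr_fun_indic// AB.
Qed.

(** A strictly positive element has a level set of positive measure, and a multiple of the element
    dominates the indicator of that set. *)
Lemma exists_indic : exists A, [/\ measurable A, A `<=` base alpha,
  0 < mu A & E (fun t => (\1_A t)%:E)].
Proof.
have [w Ew w0] := bfs_pos hB; have mw : L0 alpha w := bfs_L0 hB Ew.
have [n An] : exists n, 0 < distr_fun alpha w n.+1%:R^-1.
  apply: contrapT => H; have H0 : forall n, distr_fun alpha w n.+1%:R^-1 = 0.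
    move=> n; apply/eqP; rewrite eq_le distr_fun_ge0 andbT leNgt; apply/negP => ?.
    by apply: H; exists n.
  have w00 := ae_eq0_levels mw H0; suff : mu (base alpha) = 0.
    by rewrite measure_base// => /eqP; rewrite gt_eqF ?alpha_gt0.
  apply/negligibleP; first exact: base_measurable.
  apply: negligibleS (negligibleU w0 w00) => t bt.
  have [wt|wt] := pselect (w t = 0); [left => /= /(_ bt)|right => /= /(_ bt)//].
  by rewrite wt ltxx.
pose A n := base alpha `&` [set s | (n.+1%:R^-1)%:E < `|w s|].
have mA m : measurable (A m) by exact: measurable_level.
exists (A n); split => //; first by move=> ? [].
have En : E (fun t => (n.+1%:R)%:E * w t) := bfs_scale hB _ Ew.
refine (proj1 (space_le _ En _)).
  by apply/measurable_EFinP; exact: measurable_indic.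
move=> t bt; have [[_ /= ws]|At] := pselect (A n t).
  rewrite indic_in// abseM !abse_EFin normr1 ger0_norm//.
  have -> : 1 = (n.+1%:R)%:E * (n.+1%:R^-1)%:E :> \bar R.
    by rewrite -EFinM mulfV.
  by apply: lee_wpmul2l; rewrite ?lee_fin// ltW.
by rewrite indic_notin// abse0.
Qed.

Lemma exists_indic0 : exists2 d, (0 < d)%R & d%:E <= alpha /\
  E (fun t => (\1_(`[0%R, d[%classic) t)%:E).
Proof.
have [A [mA Ab A0 EA]] := exists_indic.
have Aa : mu A <= alpha.
  rewrite -[leRHS]measure_base//; apply: le_measure; rewrite ?inE//.
  exact: base_measurable.
(* The measure of [A] may be infinite; any finite [d] below it will do. *)
have [d d0 dA] : exists2 d, (0 < d)%R & d%:E <= mu A.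
  case: (mu A) A0 => [r||]// r0; first by exists r => //.
  by exists 1%R => //; rewrite leey.
exists d => //; split; first exact: le_trans Aa.
have sub : base (mu A) `<=` base alpha.
  by move=> t [t0 tA]; split => //; exact: lt_le_trans Aa.
have [EB _] := indic_equimeasurable mA (base_measurable (mu A)) Ab sub
  (esym (measure_base (ltW A0))) EA.
refine (proj1 (space_le _ EB _)) => [|t _].
  by apply/measurable_EFinP; exact: measurable_indic.
rewrite -base_fin; have [bt|bt] := pselect (base d%:E t); last first.
  by rewrite indic_notin// abse0.
rewrite !indic_in//; case: bt => t0 td; split => //; exact: lt_le_trans dA.
Qed.

End symmetric_spaces.

(** A vector is encoded as a function on cells of one common length, so that permuting coordinates
    preserves the distribution function. *)
Definition step_fun {R : realType} (r : R) (n : nat) (v : nat -> R) (t : R)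
    : \bar R :=
  (\sum_(k < n) v k * \1_(`[(k%:R * r)%R, (k.+1%:R * r)%R[%classic) t)%:E.

(** * Step functions on a uniform grid *)

Section step_functions.
Context {R : realType}.
Local Notation mu := (@lebesgue_measure R).
Implicit Types (r l t : R) (n : nat) (v w : nat -> R).

Local Notation cell r k := (`[(k%:R * r)%R, (k.+1%:R * r)%R[%classic).

Lemma step_fun_recr r n v t : step_fun r n.+1 v t =
  step_fun r n v t + (v n)%:E * (\1_(cell r n) t)%:E.
Proof. by rewrite /step_fun big_ord_recr EFinD EFinM. Qed.

Lemma step_fun_out r n v t : (0 <= r)%R ->
  ~ (0 <= t < n%:R * r)%R -> step_fun r n v t = 0.
Proof.
move=> r0 tn; rewrite /step_fun big1// => k _.
rewrite indic_notin ?mulr0//= in_itv/= => /andP[kt tk]; apply: tn.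
rewrite (le_trans _ kt) ?mulr_ge0//= (lt_le_trans tk)// ler_wpM2r// ler_nat.
exact: ltn_ord.
Qed.

Lemma exists_cell r t n : (0 < r)%R -> (0 <= t < n%:R * r)%R ->
  exists2 k, (k < n)%N & (k%:R * r <= t < k.+1%:R * r)%R.
Proof.
move=> r0 /andP[t0 tn].
have /truncn_itv/andP[h1 h2] : (0 <= t / r)%R by rewrite divr_ge0// ltW.
exists (Num.truncn (t / r)); last by rewrite -ler_pdivlMr// h1/= -ltr_pdivrMr.
rewrite -(ltr_nat R) (le_lt_trans h1)//.
by rewrite ltr_pdivrMr.
Qed.

Lemma cell_inj r t j k : (0 <= r)%R -> (j%:R * r <= t < j.+1%:R * r)%R ->
  (k%:R * r <= t < k.+1%:R * r)%R -> j = k.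
Proof.
move=> r0; wlog jk : j k / (j <= k)%N.
  by move=> H hj hk; case: (leqP j k) => [|/ltnW] jk; [exact: H|apply/esym/H].
move=> /andP[_ tj] /andP[kt _]; apply/eqP; rewrite eqn_leq jk/= leqNgt.
apply/negP => jk'; have := le_lt_trans kt tj.
by rewrite ltNge ler_wpM2r// ler_nat.
Qed.

Lemma step_fun_cell r n v t k : (0 <= r)%R -> (k < n)%N ->
  (k%:R * r <= t < k.+1%:R * r)%R -> step_fun r n v t = (v k)%:E.
Proof.
move=> r0 kn tk; rewrite /step_fun (bigD1 (Ordinal kn))//= big1 ?addr0.
  by rewrite indic_in ?mulr1//= in_itv.
move=> i ik; rewrite indic_notin ?mulr0//= in_itv/= => ti.
by move: ik; apply/negP; rewrite negbK; apply/eqP/val_inj/(cell_inj r0 ti tk).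
Qed.

Lemma step_fun_comb r n v w (c d : R) t :
  step_fun r n (fun k => c * v k + d * w k)%R t =
  c%:E * step_fun r n v t + d%:E * step_fun r n w t.
Proof.
rewrite /step_fun -!EFinM -EFinD; congr EFin; rewrite !mulr_sumr -big_split/=.
by apply: eq_bigr => k _; rewrite mulrDl !mulrA.
Qed.

Lemma le_step_fun r n v w t : (0 < r)%R ->
  (forall k, (k < n)%N -> `|v k| <= `|w k|)%R ->
  `|step_fun r n v t| <= `|step_fun r n w t|.
Proof.
move=> r0 vw; have [|/negP tn] := boolP (0 <= t < n%:R * r)%R; last first.
  by rewrite !step_fun_out// ltW.
move=> /(exists_cell r0)[k kn tk]; rewrite !(step_fun_cell _ (ltW r0) kn tk).
by rewrite lee_fin vw.
Qed.

Lemma measurable_step_fun r n v (D : set R) : measurable_fun D (step_fun r n v).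
Proof.
elim: n => [|n IH].
  apply: (@eq_measurable_fun _ _ _ _ _ (cst 0)) => // t _.
  by rewrite /step_fun big_ord0.
apply: (@eq_measurable_fun _ _ _ _ _
  (fun t => step_fun r n v t + (v n)%:E * (\1_(cell r n) t)%:E)).
  by move=> t _; rewrite step_fun_recr.
apply: emeasurable_funD => //; apply: measurable_funeM.
by apply/measurable_EFinP; exact: measurable_indic.
Qed.

(** Every cell has measure [r], so the measure of a level set counts coordinates; the result is
    symmetric in them. *)
Lemma distr_step_fun (alpha : \bar R) r n v l : (0 <= r)%R ->
  (n%:R * r)%:E <= alpha -> (0 <= l)%R ->
  distr_fun alpha (step_fun r n v) l =
  (\sum_(k < n) if l < `|v k| then r else 0)%:E.
Proof.
move=> r0 nra l0.
have supp m u t : l%:E < `|step_fun r m u t| -> (0 <= t < m%:R * r)%R.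
  move=> lt_; apply: contrapT => tm; move: lt_.
  by rewrite step_fun_out// abse0 lte_fin ltNge l0.
have cellN m t : cell r m t -> ~ (0 <= t < m%:R * r)%R.
  by rewrite /= in_itv/= leNgt => /andP[/negP tm _] /andP[_ /tm].
(* The support lies in the base, so the intersection with it is dropped first; the induction on [n]
   then runs without the bound by [alpha]. *)
transitivity (mu [set t | l%:E < `|step_fun r n v t|]).
  congr (mu _); apply/setIidPr => t /supp/andP[t0 tn]; split => //.
  by apply: lt_le_trans nra; rewrite lte_fin.
elim: n {nra} => [|n IH].
  rewrite big_ord0 (_ : [set _ | _] = set0) ?measure0//.
  by rewrite -subset0 => t /supp; rewrite mul0r => /andP[/le_lt_trans/[apply]]; rewrite ltxx.
rewrite big_ord_recr EFinD -IH.
have -> : (if (l < `|v n|)%R then r else 0%R)%:E =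
    mu (if (l < `|v n|)%R then cell r n else set0).
  rewrite /=; case: ifPn => _; last by rewrite measure0.
  rewrite lebesgue_measure_itv/= lte_fin -natr1 mulrDl mul1r ltrDl.
  move: r0; rewrite le_eqVlt => /predU1P[<-|->]; first by rewrite ltxx.
  by rewrite -EFinD addrC addKr.
have mlev : measurable [set t | l%:E < `|step_fun r n v t|].
  have ms : measurable_fun [set: R] (abse \o step_fun r n v).
    by apply: measurableT_comp => //; exact: measurable_step_fun.
  by rewrite -[X in measurable X]setTI; exact: emeasurable_fun_o_infty.
rewrite -measureU//; last 2 first.
- by case: ifP => // _; exact: measurable_itv.
- rewrite -subset0 => t [/supp/andP[_ tn]]; case: ifP => //= _.
  by rewrite in_itv/= => /andP[]; rewrite leNgt tn.
congr (mu _); apply/seteqP; split => t.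
  rewrite /mkset step_fun_recr => lv.
  have [tc|tc] := pselect (cell r n t); last first.
    by left; move: lv; rewrite indic_notin// mule0 adde0.
  right; move: lv; rewrite step_fun_out//; last exact: cellN.
  by rewrite add0e indic_in// mule1 abse_EFin lte_fin => ->.
move=> [|]; rewrite /mkset step_fun_recr.
  move=> lv; rewrite indic_notin ?mule0 ?adde0//= in_itv/= leNgt.
  by have /andP[_ ->] := supp _ _ _ lv.
case: ifPn => // lv tc; rewrite step_fun_out//; last exact: cellN.
by rewrite add0e indic_in// mule1 abse_EFin lte_fin.
Qed.

Lemma L0_step_fun (alpha : \bar R) r n v : L0 alpha (step_fun r n v).
Proof. exact: measurable_step_fun. Qed.

End step_functions.

(** * Majorization of vectors and norms of step functions *)

Section majorization.
Context {R : realType} (alpha : \bar R).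
Hypothesis halpha : alpha = 1%:E \/ alpha = +oo.
Variables (E : set (R -> \bar R)) (nrm : (R -> \bar R) -> R).
Hypothesis hE : symmetric_space alpha E nrm.
Local Notation mu := (@lebesgue_measure R).
Implicit Types (x y : R -> \bar R) (r l : R) (n : nat) (a b v w : nat -> R).

Let hB : banach_function_space alpha E nrm := sym_bfs hE.

Let measure_cell k r : (0 <= r)%R ->
  mu `[(k%:R * r)%R, (k.+1%:R * r)%R[%classic = r%:E.
Proof.
move=> r0; rewrite lebesgue_measure_itv/= lte_fin -natr1 mulrDl mul1r ltrDl.
move: r0; rewrite le_eqVlt => /predU1P[<-|->]; first by rewrite ltxx.
by rewrite -EFinD addrC addKr.
Qed.

Let step_fun_spaceW r n v : (0 < r)%R -> (n%:R * r)%:E <= alpha ->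
  E (fun t => (\1_(`[0%R, r[%classic) t)%:E) -> E (step_fun r n v).
Proof.
move=> r0 + E0; elim: n => [|n IH] nra.
  rewrite (_ : step_fun r 0 v = cst 0); first exact: (bfs_zero hB).
  by apply/funext => t; rewrite /step_fun big_ord0.
rewrite (_ : step_fun _ _ _ = (fun t => step_fun r n v t +
  (v n)%:E * (\1_(`[(n%:R * r)%R, (n.+1%:R * r)%R[%classic) t)%:E)); last first.
  by apply/funext => t; rewrite step_fun_recr.
apply: (bfs_add hB).
  by apply: IH; apply: le_trans nra; rewrite lee_fin ler_wpM2r ?(ltW r0)// ler_nat.
apply: (bfs_scale hB).
refine (proj1 (indic_equimeasurable hE _ _ _ _ _ E0)) => //.
- move=> t; rewrite /= in_itv/= => /andP[t0 tr]; split => //.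
  apply: lt_le_trans nra; rewrite lte_fin (lt_le_trans tr)//.
  by rewrite ler_peMl ?(ltW r0)// ler1n.
- move=> t; rewrite /= in_itv/= => /andP[t0 tr]; split.
    by rewrite (le_trans _ t0)// mulr_ge0// ltW.
  by apply: lt_le_trans nra; rewrite lte_fin.
- rewrite measure_cell ?(ltW r0)//.
  by rewrite -base_fin measure_base// lee_fin ltW.
Qed.

(** A bootstrap from one short interval: [[0, r)] is cut into cells shorter than [d], and the
    indicator of each cell is equimeasurable with a function below the indicator of [[0, d)]. *)
Lemma indic0_space r : (0 < r)%R -> r%:E <= alpha ->
  E (fun t => (\1_(`[0%R, r[%classic) t)%:E).
Proof.
move=> r0 ra; have [d d0 [da Ed]] := exists_indic0 halpha hE.
have [N Nrd] : exists N, (N.+1%:R^-1 < d / r)%R.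
  by apply: exists_natSinv_lt; rewrite divr_gt0.
have rN0 : (0 < r / N.+1%:R)%R by rewrite divr_gt0.
have rNE : (N.+1%:R * (r / N.+1%:R) = r)%R by rewrite mulrC divfK.
have EN : E (step_fun (r / N.+1%:R) N.+1 (cst 1%R)).
  apply: step_fun_spaceW => //; rewrite ?rNE//.
  refine (proj1 (space_le hE _ Ed _)) => [|t _].
    by apply/measurable_EFinP; exact: measurable_indic.
  have [tr|tr] := pselect (`[0%R, (r / N.+1%:R)%R[%classic t); last first.
    by rewrite indic_notin// abse0.
  rewrite !indic_in//; move: tr; rewrite /= !in_itv/= => /andP[-> tr]/=.
  by rewrite (lt_trans tr)// mulrC -ltr_pdivlMr.
refine (proj1 (space_le hE _ EN _)) => [|t _].
  by apply/measurable_EFinP; exact: measurable_indic.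
have [tr|tr] := pselect (`[0%R, r[%classic t); last first.
  by rewrite indic_notin// abse0.
have [k kN tk] : exists2 k, (k < N.+1)%N &
    (k%:R * (r / N.+1%:R) <= t < k.+1%:R * (r / N.+1%:R))%R.
  by apply: exists_cell => //; rewrite rNE; move: tr; rewrite /= in_itv.
by rewrite indic_in// (step_fun_cell _ (ltW rN0) kN tk).
Qed.

Lemma step_fun_space r n v : (0 < r)%R -> (n%:R * r)%:E <= alpha ->
  E (step_fun r n v).
Proof.
move=> r0; case: n => [|n] nra.
  rewrite (_ : step_fun r 0 v = cst 0); first exact: (bfs_zero hB).
  by apply/funext => t; rewrite /step_fun big_ord0.
apply: step_fun_spaceW => //; apply: indic0_space => //.
by apply: le_trans nra; rewrite lee_fin ler_peMl ?(ltW r0)// ler1n.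
Qed.

(** Equality of the sums for every [F] says that both vectors take the same values with the same
    multiplicities; applied to a threshold function it is equimeasurability. *)
Lemma norm_step_fun_eq r n v w : (0 < r)%R -> (n%:R * r)%:E <= alpha ->
  (forall F : R -> R, \sum_(k < n) F (v k) = \sum_(k < n) F (w k))%R ->
  nrm (step_fun r n v) = nrm (step_fun r n w).
Proof.
move=> r0 nra vw.
refine (proj2 (sym_distr hE (L0_step_fun _ _ _)
  (step_fun_space w r0 nra) _)) => l l0.
rewrite !distr_step_fun ?(ltW r0)//; congr EFin.
exact: (vw (fun u => if (l < `|u|)%R then r else 0%R)).
Qed.

Lemma norm_step_fun_le r n v w : (0 < r)%R -> (n%:R * r)%:E <= alpha ->
  (forall k, (k < n)%N -> `|v k| <= `|w k|)%R ->
  (nrm (step_fun r n v) <= nrm (step_fun r n w))%R.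
Proof.
move=> r0 nra vw; refine (proj2 (space_le hE (L0_step_fun _ _ _)
  (step_fun_space w r0 nra) _)) => t _.
exact: le_step_fun.
Qed.

Lemma norm_step_fun_comb r n v w (c d : R) : (0 < r)%R -> (n%:R * r)%:E <= alpha ->
  (nrm (step_fun r n (fun k => c * v k + d * w k)) <=
   `|c| * nrm (step_fun r n v) + `|d| * nrm (step_fun r n w))%R.
Proof.
move=> r0 nra; have Ev := step_fun_space v r0 nra; have Ew := step_fun_space w r0 nra.
rewrite -(bfs_norm_scale hB _ Ev) -(bfs_norm_scale hB _ Ew).
rewrite (_ : step_fun _ _ _ =
  fun t => c%:E * step_fun r n v t + d%:E * step_fun r n w t).
  by apply: (bfs_norm_triangle hB); exact: (bfs_scale hB).
by apply/funext => t; rewrite step_fun_comb.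
Qed.

Lemma norm_step_fun_transfer r n b (j k : 'I_n) (d : R) :
  (0 < r)%R -> (n%:R * r)%:E <= alpha ->
  j != k -> (0 <= d)%R -> (d <= b j - b k)%R ->
  (nrm (step_fun r n (fun i => b i - d * (i == j :> nat)%:R + d * (i == k :> nat)%:R))
   <= nrm (step_fun r n b))%R.
Proof.
move=> r0 nra jk d0 db.
have Eb := step_fun_space b r0 nra.
pose b' i := if i == j :> nat then b k else if i == k :> nat then b j else b i.
have nb' : nrm (step_fun r n b') = nrm (step_fun r n b).
  apply: norm_step_fun_eq => // F.
  rewrite [RHS](reindex_inj (@perm_inj _ (tperm j k))); apply: eq_bigr => i _.
  congr F; rewrite /b'; case: tpermP => [->|->|/eqP ij /eqP ik].
  - by rewrite eqxx.
  - by rewrite eqxx eq_sym (negbTE (_ : j != k :> nat)).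
  - by rewrite (negbTE (ij : i != j :> nat)) (negbTE (ik : i != k :> nat)).
(* Separate, because [b j - b k] may vanish when [d = 0]. *)
have [d00|dn0] := eqVneq d 0%R.
  apply: norm_step_fun_le => // i _.
  by rewrite d00 !mul0r subr0 addr0.
have bjk : (0 < b j - b k)%R by rewrite (lt_le_trans _ db)// lt_neqAle eq_sym dn0.
(* The weight at which mixing [b] with its transposition [b'] moves exactly the amount [d] from [j]
   to [k]. *)
pose th := (d / (b j - b k))%R.
have th0 : (0 <= th)%R by rewrite divr_ge0// ltW.
have th1 : (th <= 1)%R by rewrite ler_pdivrMr// mul1r.
apply: (@le_trans _ _ (nrm (step_fun r n (fun i => (1 - th) * b i + th * b' i)%R))).
  apply: norm_step_fun_le => // i _.
  suff -> : ((1 - th) * b i + th * b' i =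
      b i - d * (i == j :> nat)%:R + d * (i == k :> nat)%:R)%R by [].
  have dE : d = (th * (b j - b k))%R by rewrite /th divfK// gt_eqF.
  rewrite dE /b'; have [->|ij] := eqVneq i (j : nat).
    rewrite (negbTE (jk : j != k :> nat)) /=; ring.
  have [->|ik] := eqVneq i (k : nat) => /=; ring.
apply: (le_trans (norm_step_fun_comb _ _ _ _ r0 nra)).
by rewrite nb' !ger0_norm ?subr_ge0// -mulrDl subrK mul1r.
Qed.

(* Each transfer makes one more coordinate of [b] agree with [a]; only [a] needs to be
   monotone, so [b] need not be sorted again after a transfer. *)
Lemma norm_step_fun_majorization r n a b : (0 < r)%R -> (n%:R * r)%:E <= alpha ->
  {homo a : i j / (i <= j)%N >-> (j <= i)%R} ->
  (forall k, 0 <= a k)%R ->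
  (forall j, (j <= n)%N -> \sum_(k < j) a k <= \sum_(k < j) b k)%R ->
  (nrm (step_fun r n a) <= nrm (step_fun r n b))%R.
Proof.
move=> r0 nra a_ni a0.
have [m] := ubnP #|[pred i : 'I_n | a i != b i]|.
elim: m b => // m IH b bm ab.
have [k0|H] := pselect (exists k, (k < n)%N && (b k < a k)%R); last first.
  apply: norm_step_fun_le => // k kn.
  have abk : (a k <= b k)%R.
    by rewrite leNgt; apply/negP => bk; apply: H; exists k; exact/andP.
  by rewrite !ger0_norm// (le_trans _ abk).
(* [k] is the first deficit of [b] against [a]. *)
case: (ex_minnP k0) => k /andP[kn bak] kmin {k0}.
have ab_lt i : (i < k)%N -> (a i <= b i)%R.
  move=> ik; rewrite leNgt; apply/negP => bi.
  have := kmin i; rewrite bi (ltn_trans ik kn)/= => /(_ isT).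
  by rewrite leqNgt ik.
(* The partial sum up to and including [k] is still large enough, so an earlier coordinate must have
   a strict surplus. *)
have [j /andP[jk abj]] : exists j, (j < k)%N && (a j < b j)%R.
  apply: contrapT => H.
  have := ab k.+1 kn; rewrite !big_ord_recr/= leNgt ler_ltD//.
  apply: ler_sum => i _; rewrite leNgt; apply/negP => abi.
  by apply: H; exists (i : nat); rewrite ltn_ord.
have jn : (j < n)%N := ltn_trans jk kn.
pose J := Ordinal jn; pose K := Ordinal kn.
have JK : J != K by rewrite -val_eqE/= ltn_eqF.
(* The largest transfer that overshoots neither target: it closes the surplus at [j] or the deficit
   at [k]. Since [b k < a k <= a j < b j], it is at most [b j - b k]. *)
pose d := Num.min (b j - a j)%R (a k - b k)%R.
have d0 : (0 < d)%R by rewrite lt_min !subr_gt0 abj.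
have dj : (d <= b j - a j)%R by rewrite ge_min lexx.
have dk : (d <= a k - b k)%R by rewrite ge_min lexx orbT.
have akj : (a k <= a j)%R by apply: a_ni; exact: ltnW.
pose b' i := (b i - d * (i == j)%:R + d * (i == k)%:R)%R.
apply: (@le_trans _ _ (nrm (step_fun r n b'))); last first.
  by apply: (@norm_step_fun_transfer r n b J K) => //=; [exact: ltW|lra].
have b'j : b' j = (b j - d)%R by rewrite /b' eqxx ltn_eqF//=; ring.
have b'k : b' k = (b k + d)%R by rewrite /b' eqxx gtn_eqF//=; ring.
have b'i i : i != j -> i != k -> b' i = b i.
  by rewrite /b' => /negbTE-> /negbTE->; rewrite /=; ring.
apply: IH => [|i iN].
- rewrite -ltnS; apply: leq_trans bm; rewrite ltnS; apply: proper_card.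
  apply/properP; split.
    apply/fintype.subsetP => i; rewrite !inE; apply: contraNN => /eqP abi.
    have [ij|ij] := eqVneq (i : nat) j; first by move: abj; rewrite -ij abi ltxx.
    have [ik|ik] := eqVneq (i : nat) k; first by move: bak; rewrite -ik abi ltxx.
    by rewrite b'i// abi.
  have [e|e] := leP (b j - a j)%R (a k - b k)%R.
    exists J; rewrite !inE/=; first by rewrite lt_eqF.
    by rewrite b'j /d (min_idPl e) negbK; apply/eqP; ring.
  exists K; rewrite !inE/=; first by rewrite gt_eqF.
  by rewrite b'k /d (min_idPr (ltW e)) negbK; apply/eqP; ring.
(* Before [k] the new coordinates still dominate those of [a] one by one; once both [j] and [k] are
   included, the transfer cancels in the sum. *)
- have [ik|ki] := leqP i k.
    apply: ler_sum => l _.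
    have li : (l < k)%N by exact: leq_trans (ltn_ord l) ik.
    have [lj|lj] := eqVneq (l : nat) j; first by rewrite lj b'j; lra.
    by rewrite b'i ?ab_lt// ltn_eqF.
  rewrite /b' !big_split/= sumrN -!mulr_sumr.
  have one q : (q < i)%N -> (\sum_(l < i) ((l : nat) == q)%:R = 1 :> R)%R.
    move=> qi; rewrite (bigD1 (Ordinal qi))//= eqxx big1 ?addr0// => l.
    by rewrite -val_eqE/= => /negbTE->.
  rewrite !one ?(ltn_trans jk)// mulr1 subrK; exact: ab.
Qed.

End majorization.

(** * Fundamental function and integrals over initial intervals *)

Section norm_and_integral.
Context {R : realType} (alpha : \bar R).
Hypothesis halpha : alpha = 1%:E \/ alpha = +oo.
Variables (E : set (R -> \bar R)) (nrm : (R -> \bar R) -> R).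
Hypothesis hE : symmetric_space alpha E nrm.
Local Notation mu := (@lebesgue_measure R).
Local Notation phi := (fundamental_fun nrm).
Implicit Types (x y f g : R -> \bar R) (r l h t : R) (n : nat) (v w : nat -> R).

Let hB : banach_function_space alpha E nrm := sym_bfs hE.

(** [fundamental_fun] uses an open interval while grid cells contain their left ends; the two
    intervals have equal measure. *)
Lemma fundamental_funE h : (0 < h)%R -> h%:E <= alpha ->
  E (fun t => (\1_(`]0%R, h[%classic) t)%:E) /\
  phi h = nrm (fun t => (\1_(`[0%R, h[%classic) t)%:E).
Proof.
move=> h0 ha; apply: (indic_equimeasurable hE) => //.
- move=> t; rewrite /= in_itv/= => /andP[t0 th]; split => //.
  by apply: lt_le_trans ha; rewrite lte_fin.
- move=> t; rewrite /= in_itv/= => /andP[t0 th]; split; first exact: ltW.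
  by apply: lt_le_trans ha; rewrite lte_fin.
- by rewrite !lebesgue_measure_itv.
- exact: (indic0_space halpha hE).
Qed.

(** Extracts from an a.e. statement one point near [0]; for nonincreasing functions this point
    controls everything to its right. *)
Lemma not_negligible_base h (P : R -> Prop) : (0 < h)%R -> h%:E <= alpha ->
  ae_base alpha P -> exists2 t, (0 < t < h)%R & P t.
Proof.
move=> h0 ha aP; apply: contrapT => H.
have : mu.-negligible (`]0%R, h[%classic : set R).
  apply: negligibleS aP => t; rewrite /= in_itv/= => /andP[t0 th] /= Pt.
  apply: H; exists t; rewrite ?t0//; apply: Pt; split; first exact: ltW.
  by apply: lt_le_trans ha; rewrite lte_fin.
move/negligibleP => /(_ (measurable_itv _)); rewrite /= lebesgue_measure_itv/= lte_fin h0.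
by rewrite oppr0 adde0 => -[] h00; rewrite h00 ltxx in h0.
Qed.

Lemma fundamental_fun_gt0 h : (0 < h)%R -> h%:E <= alpha -> (0 < phi h)%R.
Proof.
move=> h0 ha; have [Eh _] := fundamental_funE h0 ha.
rewrite lt_neqAle (norm_ge0 hE Eh) andbT eq_sym; apply/eqP => ph0.
have [t th] := not_negligible_base h0 ha (bfs_norm_eq0 hB Eh ph0).
by rewrite indic_in ?in_itv//= => -[] /eqP; rewrite oner_eq0.
Qed.

Lemma le_fundamental_fun s t : (0 < s)%R -> (s <= t)%R -> t%:E <= alpha ->
  (phi s <= phi t)%R.
Proof.
move=> s0 st ta; have [Et _] := fundamental_funE (lt_le_trans s0 st) ta.
apply: (proj2 (space_le hE _ Et _)) => [|u _].
  by apply/measurable_EFinP; exact: measurable_indic.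
have [us|us] := pselect (`]0%R, s[%classic u); last first.
  by rewrite indic_notin// abse0.
rewrite !indic_in//; move: us; rewrite /= !in_itv/= => /andP[-> us]/=.
exact: lt_le_trans st.
Qed.

Lemma space_lt_pinfty g t : E g -> {homo g : s t / (s <= t)%R >-> t <= s} ->
  (0 < t)%R -> g t < +oo.
Proof.
move=> Eg g_ni t0.
have [h /andP[h0 ht] ha] : exists2 h, (0 < h <= t)%R & h%:E <= alpha.
  case: halpha => ->; last by exists t; rewrite ?t0 ?lexx ?leey.
  by exists (Num.min t 1)%R; rewrite ?lee_fin ?lt_min ?t0 ?ltr01 ge_min lexx ?orbT.
have [s /andP[s0 sh] gs] := not_negligible_base h0 ha (space_ae_finite hE Eg).
by rewrite (le_lt_trans _ (le_lt_trans (lee_abs _) gs))// g_ni// (le_trans (ltW sh)).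
Qed.

Lemma norm_step_fun_le_fun g r n v : E g ->
  {homo g : s t / (s <= t)%R >-> t <= s} -> (0 < r)%R -> (n%:R * r)%:E <= alpha ->
  (forall k, (k < n)%N -> (0 <= v k)%R /\ (v k)%:E <= g (k.+1%:R * r)%R) ->
  (nrm (step_fun r n v) <= nrm g)%R.
Proof.
move=> Eg g_ni r0 nra vg; refine (proj2 (space_le hE (L0_step_fun _ _ _) Eg _)) => t _.
have [|/negP tn] := boolP (0 <= t < n%:R * r)%R; last first.
  by rewrite step_fun_out ?abse0// ltW.
move=> /(exists_cell r0)[k kn tk]; rewrite (step_fun_cell _ (ltW r0) kn tk).
have [v0 vk] := vg _ kn; rewrite abse_EFin ger0_norm//.
apply: le_trans (lee_abs _); apply: (le_trans vk); apply: g_ni.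
by apply: ltW; case/andP: tk.
Qed.

Lemma sum_average_le (b : nat -> R) i j : {homo b : i j / (i <= j)%N >-> (j <= i)%R} ->
  (i <= j)%N -> (i%:R * \sum_(k < j) b k <= j%:R * \sum_(k < i) b k)%R.
Proof.
move=> b_ni /subnK <-; elim: (j - i)%N => // d IH.
rewrite addSn big_ord_recr/= mulrDr -natr1 mulrDl mul1r; apply: lerD => //.
rewrite mulr_natl -[X in (_ *+ X)%R]card_ord -sumr_const; apply: ler_sum => l _.
by apply: b_ni; rewrite (leq_trans (ltnW (ltn_ord l)))// leq_addl.
Qed.

(* The constant vector of mean values is majorized by the vector of grid values of [g]. *)
Lemma integral0_le_norm g h : E g -> {homo g : s t / (s <= t)%R >-> t <= s} ->
  (forall t, 0 <= g t) -> (0 < h)%R -> h%:E <= alpha ->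
  \int[mu]_(s in `[0%R, h]) g s <= (h * nrm g / phi h)%:E.
Proof.
move=> Eg g_ni g_ge0 h0 ha; have phi0 := fundamental_fun_gt0 h0 ha.
have [_ phiE] := fundamental_funE h0 ha.
(* With mesh [h / n.+1], the remaining interval omits exactly the first cell of the grid. *)
apply: integral0_le_limit => // n.
pose r := (h / n.+1%:R)%R.
have r0 : (0 < r)%R by rewrite divr_gt0.
have nrh : (n.+1%:R * r = h)%R by rewrite /r mulrC divfK.
have nra : (n.+1%:R * r)%:E <= alpha by rewrite nrh.
pose b k := fine (g (k.+1%:R * r)%R).
have gfin k : g (k.+1%:R * r)%R \is a fin_num.
  by rewrite ge0_fin_numE//; apply: space_lt_pinfty => //; rewrite mulr_gt0.
have bE k : (b k)%:E = g (k.+1%:R * r)%R by rewrite fineK.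
have b0 k : (0 <= b k)%R by rewrite fine_ge0.
have b_ni : {homo b : i j / (i <= j)%N >-> (j <= i)%R}.
  move=> i j ij; rewrite -lee_fin !bE; apply: g_ni.
  by rewrite ler_wpM2r ?(ltW r0)// ler_nat.
pose S := (\sum_(k < n.+1) b k)%R.
have S0 : (0 <= S)%R by exact: sumr_ge0.
pose c := (S / n.+1%:R)%R.
have c0 : (0 <= c)%R by rewrite divr_ge0.
have H1 : (nrm (step_fun r n.+1 (fun=> c)) <= nrm g)%R.
  apply: (@le_trans _ _ (nrm (step_fun r n.+1 b))); last first.
    by apply: norm_step_fun_le_fun => // k _; rewrite bE.
  apply: (norm_step_fun_majorization halpha hE) => // j jn.
  rewrite sumr_const card_ord -mulr_natl /c mulrA ler_pdivrMr// [leRHS]mulrC.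
  exact: sum_average_le.
have H2 : (c * phi h <= nrm g)%R.
  apply: le_trans H1; rewrite phiE -{1}(ger0_norm c0).
  rewrite -(bfs_norm_scale hB _ (indic0_space halpha hE h0 ha)).
  rewrite le_eqVlt; apply/orP; left; apply/eqP; congr nrm; apply/funext => t.
  have [th|th] := boolP (0 <= t < n.+1%:R * r)%R; last first.
    rewrite step_fun_out ?(ltW r0)//; last exact/negP.
    by rewrite indic_notin ?mule0//= in_itv/= -nrh; exact/negP.
  have [k kn tk] := exists_cell r0 th; rewrite (step_fun_cell _ (ltW r0) kn tk).
  by rewrite indic_in ?mule1//= in_itv/= -nrh.
rewrite -[X in `]_, X]]nrh.
apply: (le_trans (integral_le_sum g_ni g_ge0 n (ltW r0))).
apply: (@le_trans _ _ (\sum_(k < n.+1) r%:E * (b k)%:E)).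
  rewrite big_ord_recr/= -[leLHS]adde0; apply: leeD.
    by apply: lee_sum => k _; rewrite bE.
  by rewrite lee_fin mulr_ge0// ltW.
rewrite -ge0_sume_distrr; last by move=> k _; rewrite lee_fin.
rewrite sumEFin -EFinM lee_fin ler_pdivlMr//.
have -> : (r * (\sum_(i < n.+1) b i) * phi h = h * (c * phi h))%R.
  by rewrite /r /c /S; ring.
by rewrite ler_pM2l.
Qed.

End norm_and_integral.

Lemma ge0_le_ereal {R : realFieldType} (x y : \bar R) : 0 <= y ->
  (forall l : R, l%:E < x -> l%:E <= y) -> x <= y.
Proof.
case: y => [y||]; [move=> y0 H|by move=> _ _; exact: leey|by []].
rewrite leNgt; apply/negP; case: x H => [x||] H //.
  rewrite lte_fin => yx; have := H ((y + x) / 2)%R; rewrite lte_fin lee_fin.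
  by move=> /(_ (midf_lt yx).2); rewrite leNgt midf_lt.
move=> _; have := H (y + 1)%R (ltry _).
by rewrite lee_fin leNgt ltrDl ltr01.
Qed.

(** * Domination of primitives implies domination of norms up to a factor 2 *)

Section norm_monotonicity.
Context {R : realType} (alpha : \bar R).
Hypothesis halpha : alpha = 1%:E \/ alpha = +oo.
Variables (E : set (R -> \bar R)) (nrm : (R -> \bar R) -> R).
Hypothesis hE : symmetric_space alpha E nrm.
Hypothesis hF : fatou_property alpha E nrm.
Local Notation mu := (@lebesgue_measure R).
Local Notation phi := (fundamental_fun nrm).

Let hB : banach_function_space alpha E nrm := sym_bfs hE.

Variables f g : R -> \bar R.
Hypothesis Eg : E g.
Hypothesis f_ni : {homo f : s t / (s <= t)%R >-> t <= s}.
Hypothesis f_ge0 : forall t, 0 <= f t.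
Hypothesis g_ni : {homo g : s t / (s <= t)%R >-> t <= s}.
Hypothesis g_ge0 : forall t, 0 <= g t.
Hypothesis f_rc : forall (t l : R), l%:E < f t -> exists2 s, (t < s)%R & l%:E < f s.
Hypothesis fg : forall t, (0 < t)%R -> t%:E <= alpha ->
  \int[mu]_(s in `[0%R, t]) f s <= \int[mu]_(s in `[0%R, t]) g s.

Let int_fin h : (0 < h)%R -> h%:E <= alpha ->
  \int[mu]_(s in `[0%R, h]) g s < +oo.
Proof.
move=> h0 ha; apply: le_lt_trans (ltry _).
exact: (integral0_le_norm halpha hE Eg).
Qed.

Let f_fin t : (0 < t)%R -> t%:E <= alpha -> f t \is a fin_num.
Proof.
move=> t0 ta; rewrite ge0_fin_numE//.
have : t%:E * f t < +oo.
  apply: (le_lt_trans (integral0_ge f_ni f_ge0 (ltW t0))).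
  exact: le_lt_trans (fg t0 ta) (int_fin t0 ta).
by case: (f t) => [q||]; rewrite ?ltry ?ltNyy// gt0_muley ?lte_fin// ltxx.
Qed.

(** Right end values give a step function below [f] and avoid [f 0], which may be infinite. *)
Let lower (r : R) k := fine (f (k.+1%:R * r)%R).

Let lowerE (r : R) n k : (0 < r)%R -> (n%:R * r)%:E <= alpha -> (k < n)%N ->
  (lower r k)%:E = f (k.+1%:R * r)%R.
Proof.
move=> r0 nra kn; rewrite fineK//; apply: f_fin; first by rewrite mulr_gt0.
by apply: le_trans nra; rewrite lee_fin ler_wpM2r ?(ltW r0)// ler_nat.
Qed.

Let gfin t : (0 < t)%R -> g t \is a fin_num.
Proof. by move=> t0; rewrite ge0_fin_numE// (space_lt_pinfty halpha hE Eg). Qed.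

(* The grid values of [f] are majorized by the mean of [g] over the first cell followed by
   the grid values of [g]; shifted by one cell, the latter form a lower step function of
   [g].  Each of the two parts costs [nrm g]. *)
Let norm_lower_le (r : R) n : (0 < r)%R -> (0 < n)%N -> (n%:R * r)%:E <= alpha ->
  (nrm (step_fun r n (lower r)) <= 2 * nrm g)%R.
Proof.
move=> r0; case: n => // n _ nra.
have ra : r%:E <= alpha.
  by apply: le_trans nra; rewrite lee_fin ler_peMl ?(ltW r0)// ler1n.
pose G := fine (\int[mu]_(s in `[0%R, r]) g s).
have GE : G%:E = \int[mu]_(s in `[0%R, r]) g s.
  by rewrite fineK// ge0_fin_numE ?integral0_ge0// int_fin.
have G0 : (0 <= G)%R by rewrite fine_ge0// integral0_ge0.
have phi0 := fundamental_fun_gt0 halpha hE r0 ra.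
have Gphi : (G / r * phi r <= nrm g)%R.
  have := integral0_le_norm halpha hE Eg g_ni g_ge0 r0 ra.
  rewrite -GE lee_fin ler_pdivlMr// => H.
  by rewrite mulrAC ler_pdivrMr// [leRHS]mulrC.
pose head k : R := if k is 0%N then (G / r)%R else 0%R.
pose tail k : R := if k is k'.+1 then fine (g (k'.+1%:R * r)%R) else 0%R.
have tailE k : (tail k.+1)%:E = g (k.+1%:R * r)%R.
  by rewrite fineK// gfin// mulr_gt0.
apply: (@le_trans _ _ (nrm (step_fun r n.+1 (fun k => 1 * head k + 1 * tail k)%R))).
  (* The majorization lemma asks for monotonicity and positivity at all indices; beyond the grid the
     vector is set to 0. *)
  pose a k := if (k <= n)%N then lower r k else 0%R.
  apply: (@le_trans _ _ (nrm (step_fun r n.+1 a))).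
    apply: (norm_step_fun_le halpha hE) => // k kn.
    by rewrite /a -ltnS kn.
  apply: (norm_step_fun_majorization halpha hE) => //.
  - move=> i j ij; rewrite /a; case: ifPn => jn; last first.
      by case: ifPn => // _; rewrite fine_ge0.
    rewrite (leq_trans ij jn) -lee_fin !(lowerE r0 nra)//; last first.
      by rewrite ltnS (leq_trans ij).
    by apply: f_ni; rewrite ler_wpM2r ?(ltW r0)// ler_nat.
  - by move=> k; rewrite /a; case: ifPn => // _; rewrite fine_ge0.
  - case=> [|j] jn; first by rewrite !big_ord0.
    have jra : (j.+1%:R * r)%:E <= alpha.
      by apply: le_trans nra; rewrite lee_fin ler_wpM2r ?(ltW r0)// ler_nat.
    (* Multiplied by [r], the left side is a lower Riemann sum of [f]; the right side is an upper
       sum of [g] in which the first cell contributes its exact integral. *)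
    rewrite -(ler_pM2l r0) !mulr_sumr -lee_fin -!sumEFin.
    apply: (@le_trans _ _ (\int[mu]_(s in `[0%R, (j.+1%:R * r)%R]) f s)).
      apply: le_trans (sum_le_integral0 f_ni f_ge0 _ (ltW r0)).
      apply: lee_sum => k _; rewrite EFinM /a.
      have kn : (k <= n)%N by rewrite -ltnS (leq_trans (ltn_ord k)).
      by rewrite kn (lowerE r0 nra).
    apply: (le_trans (fg _ jra)); first by rewrite mulr_gt0.
    have rj : (r <= j.+1%:R * r)%R by rewrite ler_peMl ?(ltW r0)// ler1n.
    rewrite (integral0_split g_ni g_ge0 (ltW r0) rj) big_ord_recl; apply: leeD.
      rewrite -GE lee_fin /= mulr0 addr0 mul1r.
      by rewrite mulrC divfK// gt_eqF.
    apply: (le_trans (integral_le_sum g_ni g_ge0 _ (ltW r0))).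
    apply: lee_sum => k _.
    by rewrite lift0 /head mulr0 add0r mul1r EFinM tailE.
apply: (le_trans (norm_step_fun_comb halpha hE _ _ _ _ r0 nra)).
rewrite normr1 !mul1r (_ : 2 * nrm g = nrm g + nrm g)%R; last by ring.
apply: lerD.
  apply: le_trans Gphi.
  have [_ ->] := fundamental_funE halpha hE r0 ra.
  have Gr0 : (0 <= G / r)%R by rewrite divr_ge0// ltW.
  rewrite -{1}(ger0_norm Gr0) -(bfs_norm_scale hB _ (indic0_space halpha hE r0 ra)).
  refine (proj2 (space_le hE (L0_step_fun _ _ _) _ _)).
    by apply: (bfs_scale hB); exact: (indic0_space halpha hE).
  move=> t _; have [|/negP tn] := boolP (0 <= t < n.+1%:R * r)%R; last first.
    by rewrite step_fun_out ?abse0// ltW.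
  move=> /(exists_cell r0)[k kn tk]; rewrite (step_fun_cell _ (ltW r0) kn tk).
  case: k kn tk => [|k] _ tk; last by rewrite abse0.
  by rewrite indic_in ?mule1//= in_itv/=; move: tk; rewrite mul0r mul1r.
pose w k := if (k < n)%N then tail k.+1 else 0%R.
rewrite (norm_step_fun_eq halpha hE (w := w) r0 nra) => [|F].
  apply: (norm_step_fun_le_fun hE) => // k kn; rewrite /w; case: ifPn => _.
    by rewrite tailE fine_ge0.
  by split.
rewrite big_ord_recl big_ord_recr/= /w ltnn addrC; congr (_ + _)%R.
by apply: eq_bigr => k _; rewrite ltn_ord.
Qed.

(** Dyadic grids on [[0, T m)]: halving the mesh makes the lower step functions increase, as the
    Fatou property requires, and for an infinite base the horizon grows along with the
    refinement. *)
Let T m : nat := if alpha == +oo then m.+1 else 1%N.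
Let r m : R := (2 ^- m)%R.
Let N m : nat := (T m * 2 ^ m)%N.

Let r_gt0 m : (0 < r m)%R. Proof. by rewrite invr_gt0 exprn_gt0. Qed.

Let NrE m : ((N m)%:R * r m = (T m)%:R)%R.
Proof. by rewrite /N /r natrM natrX mulfK// expf_neq0. Qed.

Let N_gt0 m : (0 < N m)%N.
Proof. by rewrite muln_gt0 expn_gt0 /T; case: ifP. Qed.

Let Nra m : ((N m)%:R * r m)%:E <= alpha.
Proof.
by rewrite NrE /T; case: halpha => ->; rewrite ?eqxx ?leey.
Qed.

Let u m := step_fun (r m) (N m) (lower (r m)).

Let u_ge0 m t : 0 <= u m t.
Proof.
have [|/negP tn] := boolP (0 <= t < (N m)%:R * r m)%R; last first.
  by rewrite /u step_fun_out ?abse0// ltW.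
move=> /(exists_cell (r_gt0 m))[k kn tk].
by rewrite /u (step_fun_cell _ (ltW (r_gt0 m)) kn tk) lee_fin fine_ge0.
Qed.

Let u_nondecreasing t m : u m t <= u m.+1 t.
Proof.
have [tm|/negP tn] := boolP (0 <= t < (N m)%:R * r m)%R; last first.
  by rewrite /u step_fun_out ?(ltW (r_gt0 m))// u_ge0.
have [k kn tk] := exists_cell (r_gt0 m) tm.
have tm1 : (0 <= t < (N m.+1)%:R * r m.+1)%R.
  case/andP: tm => -> /= tm; apply: (lt_le_trans tm); rewrite !NrE ler_nat /T.
  by case: ifP.
have [k' k'n tk'] := exists_cell (r_gt0 m.+1) tm1.
rewrite /u (step_fun_cell _ (ltW (r_gt0 m)) kn tk).
rewrite (step_fun_cell _ (ltW (r_gt0 m.+1)) k'n tk').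
rewrite (lowerE (r_gt0 _) (Nra m) kn) (lowerE (r_gt0 _) (Nra m.+1) k'n).
have rm : r m = (2 * r m.+1)%R.
  by rewrite /r exprS invfM mulrA divff ?mul1r.
apply: f_ni; rewrite rm mulrA -natrM ler_wpM2r ?(ltW (r_gt0 _))// ler_nat.
rewrite -(ltr_nat R) -(ltr_pM2r (r_gt0 m.+1)).
have /andP[h _] := tk'; apply: (le_lt_trans h).
by have /andP[_] := tk; rewrite rm mulrA natrM.
Qed.

Let u_le t m : base alpha t -> u m t <= f t.
Proof.
move=> bt; have [|/negP tn] := boolP (0 <= t < (N m)%:R * r m)%R; last first.
  by rewrite /u step_fun_out// ltW.
move=> /(exists_cell (r_gt0 m))[k kn tk].
rewrite /u (step_fun_cell _ (ltW (r_gt0 m)) kn tk) (lowerE (r_gt0 m) (Nra m) kn).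
by apply: f_ni; apply: ltW; case/andP: tk.
Qed.

Let u_cvg t : base alpha t -> u m t @[m --> \oo] --> f t.
Proof.
move=> bt; have nd : nondecreasing_seq (u ^~ t).
  by apply/nondecreasing_seqP => m; exact: u_nondecreasing.
rewrite (_ : f t = ereal_sup (range (u ^~ t))); first exact: ereal_nondecreasing_cvgn.
apply/eqP; rewrite eq_le; apply/andP; split; last first.
  by apply: ge_ereal_sup => _ [m _ <-]; exact: u_le.
(* Right continuity gives [s > t] with [f s] still above [l]. Once the mesh is at most [s - t] and
   the horizon exceeds [t], the right end of the cell of [t] is at most [s]. *)
apply: ge0_le_ereal => [|l /f_rc[s ts lfs]].
  by apply: le_trans (u_ge0 0 t) _; apply: ereal_sup_ubound; exists 0%N.
have [n1 n1t] : exists n, (t < (T n)%:R)%R.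
  rewrite /T; case: halpha bt => -> [t0].
    by rewrite lte_fin => t1; exists 0%N.
  by move=> _; rewrite eqxx; exists (Num.truncn t); exact: truncnS_gt.
have st0 : (0 < s - t)%R by rewrite subr_gt0.
have [n2 n2s] := exists_natSinv_lt st0.
pose m := maxn n1 n2.
have tm : (0 <= t < (N m)%:R * r m)%R.
  case: bt => -> _ /=; apply: (lt_le_trans n1t); rewrite NrE ler_nat /T.
  by case: ifP => // _; rewrite ltnS leq_maxl.
have rs : (r m <= s - t)%R.
  apply: le_trans (ltW n2s); rewrite lef_pV2 ?posrE ?exprn_gt0//.
  rewrite -natrX ler_nat; apply: (leq_trans _ (ltn_expl m (isT : 1 < 2)%N)).
  by rewrite ltnS leq_maxr.
apply: le_trans (_ : u m t <= _); last by apply: ereal_sup_ubound; exists m.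
have [k kn tk] := exists_cell (r_gt0 m) tm.
rewrite /u (step_fun_cell _ (ltW (r_gt0 m)) kn tk) (lowerE (r_gt0 m) (Nra m) kn).
apply: (le_trans (ltW lfs)); apply: f_ni.
rewrite -natr1 mulrDl mul1r; case/andP: tk => tk _.
by rewrite -lerBrDr (le_trans tk)// lerBrDr -lerBrDl.
Qed.

(** Membership of [f] in [E] is part of the conclusion: the Fatou property extracts it from the
    uniform bound on the lower step functions. *)
Lemma norm_le_of_integral_le : E f /\ (nrm f <= 2 * nrm g)%R.
Proof.
have Eu m : E (u m) by exact: (step_fun_space halpha hE).
have u_bnd m : (nrm (u m) <= 2 * nrm g)%R by exact: norm_lower_le.
have [|||||Ef _ nf] := hF (u := u) (x := f).
- by move=> m; split => //; apply: ae_baseW => t _; exact: u_ge0.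
- by exists (2 * nrm g)%R => _ [m _ <-]; exact: u_bnd.
- exact: L0_nonincreasing.
- by move=> m; apply: ae_baseW => t _; exact: u_nondecreasing.
- by apply: ae_baseW => t; exact: u_cvg.
split => //; rewrite -(cvg_lim _ nf)//; apply: limr_le; last exact: nearW.
by apply/cvg_ex; eexists; exact: nf.
Qed.

End norm_monotonicity.


(** * Comparing integrals through integer levels *)

Section integer_levels.
Context {R : realType}.
Local Notation mu := (@lebesgue_measure R).
Implicit Types (D : set R) (f : R -> \bar R) (n k : nat).

Let level D f k := D `&` [set t | k%:R%:E < f t].

Let measurable_lev D f k : measurable D -> measurable_fun D f ->
  measurable (level D f k).
Proof. by move=> mD mf; exact: emeasurable_fun_o_infty. Qed.

(** A discrete layer cake: it counts the integers [k < n] below [f t], and its integral is a sum of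
    measures of level sets. *)
Let count D f n (t : R) : \bar R := \sum_(k < n) (\1_(level D f k) t)%:E.

Let count_recr D f n t : D t ->
  count D f n.+1 t = count D f n t + (if n%:R%:E < f t then 1 else 0).
Proof.
move=> Dt; rewrite /count big_ord_recr/=; congr (_ + _).
by case: ifPn => nf; [rewrite indic_in|rewrite indic_notin// => -[_]; exact/negP].
Qed.

Let count0 D f t : count D f 0 t = 0. Proof. by rewrite /count big_ord0. Qed.

Let mine_le_count D f n t : D t -> 0 <= f t -> mine (f t) n%:R%:E <= count D f n t.
Proof.
move=> Dt f0; elim: n => [|n IH]; first by rewrite count0 ge_min lexx orbT.
rewrite count_recr//; case: ifPn => nf.
  apply: (@le_trans _ _ (n%:R%:E + 1)).
    by rewrite ge_min -EFinD natr1 lexx orbT.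
  by apply: leeD => //; apply: le_trans IH; rewrite le_min lexx (ltW nf).
rewrite adde0; apply: le_trans IH; rewrite le_min ge_min lexx/=.
by rewrite ge_min leNgt nf.
Qed.

Let count_le D f n t : D t -> 0 <= f t -> count D f n t <= f t + 1.
Proof.
move=> Dt f0.
suff : count D f n t <= mine (f t + 1) n%:R%:E by rewrite le_min => /andP[].
elim: n => [|n IH]; first by rewrite count0 le_min lexx adde_ge0.
rewrite count_recr//; case: ifPn => nf.
  rewrite le_min; apply/andP; split; last first.
    by rewrite -natr1 EFinD leeD2r// (le_trans IH)// ge_min lexx orbT.
  apply: (@le_trans _ _ (n%:R%:E + 1)); first by rewrite leeD2r// (le_trans IH)// ge_min lexx orbT.
  by rewrite leeD2r// ltW.
rewrite adde0 (le_trans IH)// le_min ge_min lexx/= ge_min lee_fin ler_nat leqnSn.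
by rewrite orbT.
Qed.

Let measurable_count D f n : measurable D -> measurable_fun D f ->
  measurable_fun D (count D f n).
Proof.
move=> mD mf; apply: emeasurable_sum => k.
by apply/measurable_EFinP; apply: measurable_indic; exact: measurable_lev.
Qed.

Let count_ge0 D f n t : 0 <= count D f n t.
Proof. by apply: sume_ge0 => k _; rewrite lee_fin. Qed.

Let integral_count D f n : measurable D -> measurable_fun D f ->
  \int[mu]_(t in D) count D f n t = \sum_(k < n) mu (level D f k).
Proof.
move=> mD mf; rewrite ge0_integral_sum//.
  apply: eq_bigr => k _; rewrite integral_indic//; last exact: measurable_lev.
  by congr (mu _); rewrite /level setIAC setIid.
by move=> k; apply/measurable_EFinP; apply: measurable_indic; exact: measurable_lev.
Qed.

(* [min (f1, n)] is at most the number of [k < n] with [k < f1], and the number of [k] with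
   [k < f2] is at most [f2 + 1]. *)
Lemma integral_le_of_integer_levels D1 D2 f1 f2 :
  measurable D1 -> measurable D2 -> measurable_fun D1 f1 -> measurable_fun D2 f2 ->
  (forall t, D1 t -> 0 <= f1 t) -> (forall t, D2 t -> 0 <= f2 t) ->
  (forall k : nat, mu (D1 `&` [set t | k%:R%:E < f1 t]) <=
    mu (D2 `&` [set t | k%:R%:E < f2 t])) ->
  \int[mu]_(t in D1) f1 t <= \int[mu]_(t in D2) f2 t + mu D2.
Proof.
move=> mD1 mD2 mf1 mf2 f10 f20 H.
have mmin n : measurable_fun D1 (fun t => mine (f1 t) n%:R%:E).
  exact: measurable_mine.
have step n : \int[mu]_(t in D1) mine (f1 t) n%:R%:E <=
    \int[mu]_(t in D2) f2 t + mu D2.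
  apply: (@le_trans _ _ (\int[mu]_(t in D1) count D1 f1 n t)).
    apply: ge0_le_integral => //; [|exact: mmin|exact: measurable_count|].
      by move=> t Dt; rewrite le_min f10//= lee_fin.
    by move=> t Dt; apply: mine_le_count => //; exact: f10.
  apply: (@le_trans _ _ (\int[mu]_(t in D2) count D2 f2 n t)).
    by rewrite !integral_count//; apply: lee_sum => k _; exact: H.
  have -> : \int[mu]_(t in D2) f2 t + mu D2 = \int[mu]_(t in D2) (f2 t + cst 1 t).
    by rewrite ge0_integralD// integral_cst// mul1e.
  apply: ge0_le_integral => //; [exact: measurable_count|exact: emeasurable_funD|].
  by move=> t Dt; apply: count_le => //; exact: f20.
have min_nd t : nondecreasing_seq (fun n => mine (f1 t) n%:R%:E).
  move=> m n mn; rewrite le_min ge_min lexx/= ge_min.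
  by rewrite lee_fin ler_nat mn orbT.
have cv : \int[mu]_(t in D1) mine (f1 t) n%:R%:E @[n --> \oo] -->
    \int[mu]_(t in D1) (fun t => lim (mine (f1 t) n%:R%:E @[n --> \oo])) t.
  apply: cvg_monotone_convergence => //.
    by move=> n t Dt; rewrite le_min f10//= lee_fin.
have -> : \int[mu]_(t in D1) f1 t =
    \int[mu]_(t in D1) (fun t => lim (mine (f1 t) n%:R%:E @[n --> \oo])) t.
  apply: eq_integral => t /[!inE] Dt; apply/esym/cvg_lim => //.
  rewrite [X in _ --> X](_ : _ = ereal_sup (range (fun n => mine (f1 t) n%:R%:E))).
    exact/ereal_nondecreasing_cvgn/min_nd.
  apply/eqP; rewrite eq_le; apply/andP; split; last first.
    by apply: ge_ereal_sup => _ [n _ <-]; rewrite ge_min lexx.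
  apply: ge0_le_ereal => [|l lf].
    apply: (@le_trans _ _ (mine (f1 t) 0%:R%:E)); first by rewrite le_min f10/=.
    by apply: ereal_sup_ubound; exists 0%N.
  apply: (@le_trans _ _ (mine (f1 t) (Num.truncn l).+1%:R%:E)).
    by rewrite le_min (ltW lf) lee_fin ltW// truncnS_gt.
  by apply: ereal_sup_ubound; exists (Num.truncn l).+1.
rewrite -(cvg_lim _ cv)//; apply: lime_le; first by apply/cvg_ex; eexists; exact: cv.
exact: nearW.
Qed.

End integer_levels.

(** * Embedding into the sum of [L^1] and [L^oo] *)

Section embedding.
Context {R : realType} (alpha : \bar R).
Hypothesis halpha : alpha = 1%:E \/ alpha = +oo.
Variables (E : set (R -> \bar R)) (nrm : (R -> \bar R) -> R).
Hypothesis hE : symmetric_space alpha E nrm.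
Local Notation mu := (@lebesgue_measure R).
Local Notation phi := (fundamental_fun nrm).
Local Notation "x ^*" := (decr_rearr alpha x).
Implicit Types (x y : R -> \bar R) (h l t : R).

Let hB : banach_function_space alpha E nrm := sym_bfs hE.
Let alpha_ge0 : 0 <= alpha := ltW (alpha_gt0 halpha).

Lemma decr_rearr_lt_pinfty y t : E y -> (0 < t)%R -> y^* t < +oo.
Proof.
move=> Ey t0; apply: (space_lt_pinfty halpha hE) => //.
  exact: (space_decr_rearr halpha hE Ey).1.
exact: decr_rearr_nonincreasing.
Qed.

Lemma integral0_decr_rearr_le y h : E y -> (0 < h)%R -> h%:E <= alpha ->
  \int[mu]_(s in `[0%R, h]) y^* s <= (h * nrm y / phi h)%:E.
Proof.
move=> Ey h0 ha; have [Ey' <-] := space_decr_rearr halpha hE Ey.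
apply: (integral0_le_norm halpha hE) => //.
  exact: decr_rearr_nonincreasing.
exact: decr_rearr_ge0.
Qed.

(** Needed because [hlp_prec] includes this membership. Cutting at height [y^*(1)] leaves above it a
    set of measure at most 1, on which the integral of [|y|] is controlled by that of [y^*] over
    [[0, 1]]. *)
Lemma space_L1_plus_Linfty y : E y -> L1_plus_Linfty alpha y.
Proof.
move=> Ey; have my : L0 alpha y := bfs_L0 hB Ey; split => //.
pose M := fine (y^* 1%R).
have ME : M%:E = y^* 1%R.
  by rewrite fineK// ge0_fin_numE ?decr_rearr_ge0// decr_rearr_lt_pinfty.
have M0 : (0 <= M)%R by rewrite fine_ge0// decr_rearr_ge0.
pose A := base alpha `&` [set s | M%:E < `|y s|].
have mA : measurable A by exact: measurable_level.
have mind (B : set R) : measurable B ->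
    measurable_fun (base alpha) (fun t => y t * (\1_B t)%:E).
  move=> mB; apply: emeasurable_funM => //.
  by apply/measurable_EFinP; exact: measurable_indic.
exists (fun t => y t * (\1_A t)%:E), (fun t => y t * (\1_(~` A) t)%:E).
split.
- apply/integrableP; split; first exact: mind.
  apply: (@le_lt_trans _ _ (\int[mu]_(s in `[0%R, 1%R]) y^* s +
      mu `[0%R, 1%R]%classic)); last first.
    rewrite lebesgue_measure_itv/= lte_fin ltr01 -EFinD lte_add_pinfty ?ltry//.
    apply: (le_lt_trans (integral0_decr_rearr_le Ey ltr01 _)); last exact: ltry.
    by case: halpha => ->; rewrite ?leey.
  apply: integral_le_of_integer_levels => //.
  + exact: base_measurable.
  + by apply: measurableT_comp => //; exact: mind.
  + exact: (measurable_funTS (measurable_decr_rearr alpha y)).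
  + by move=> t _; exact: decr_rearr_ge0.
  (* On [A] the function already exceeds [M], so the level set at [k] of the cut function is that of
     [y] at [max (k, M)]. *)
  move=> k; pose l := Num.max k%:R M.
  have l0 : (0 <= l)%R by rewrite le_max M0 orbT.
  have d1 : distr_fun alpha y l <= 1%:E.
    by rewrite leNgt -lt_decr_rearr// -leNgt -ME lee_fin le_max lexx orbT.
  apply: (@le_trans _ _ (distr_fun alpha y l)).
    apply: le_measure; rewrite ?inE; [|exact: measurable_level|].
      apply: emeasurable_fun_o_infty; first exact: base_measurable.
      by apply: measurableT_comp => //; exact: mind.
    move=> t [bt /=]; have [[_ /= Mt]|At] := pselect (A t).
      by rewrite indic_in// mule1 => kt; split => //=; rewrite EFin_max gt_max kt.
    by rewrite indic_notin// mule0 abse0 lte_fin ltNge ler0n.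
  rewrite -[leLHS]measure_base ?distr_fun_ge0//.
  apply: le_measure; rewrite ?inE; first exact: base_measurable.
    apply: emeasurable_fun_o_infty => //.
    exact: (measurable_funTS (measurable_decr_rearr alpha y)).
  move=> t [t0 td]; split => /=.
    by rewrite in_itv/= t0 -lee_fin ltW// (lt_le_trans td).
  apply: (@le_lt_trans _ _ l%:E); first by rewrite lee_fin le_max lexx.
  by rewrite lt_decr_rearr.
- by apply: mind; exact: measurableC.
- exists M; apply: ae_baseW => t bt; have [At|At] := pselect (A t).
    by rewrite indic_notin ?mule0 ?abse0 ?lee_fin//; exact.
  rewrite indic_in// mule1 leNgt; apply/negP => Mt; exact: At.
- apply: ae_baseW => t bt; have [At|At] := pselect (A t).
    by rewrite indic_in// indic_notin ?mule0 ?adde0 ?mule1//; exact.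
  by rewrite indic_notin// indic_in// mule0 add0e mule1.
Qed.

End embedding.

Lemma ge0_cvge0P {R : realType} {I : Type} {F : set_system I} {FF : Filter F}
    (f : I -> \bar R) : (forall i, 0 <= f i) ->
  f @ F --> (0 : \bar R) <-> (forall e : R, (0 < e)%R -> \forall i \near F, f i <= e%:E).
Proof.
move=> f0; split.
  move=> /fine_cvgP[ffin /cvgrPdist_le fF] e e0; near=> i.
  have fi : f i \is a fin_num by near: i.
  rewrite -(fineK fi) lee_fin -(ger0_norm (fine_ge0 (f0 i))) -normrN -sub0r.
  by near: i; exact: fF.
move=> H; apply/fine_cvgP; split.
  near=> i; rewrite ge0_fin_numE// (@le_lt_trans _ _ 1%:E) ?ltry//.
  by near: i; exact: H.
apply/cvgrPdist_le => e e0; near=> i.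
have fi : f i <= e%:E by near: i; exact: H.
have ffin : f i \is a fin_num by rewrite ge0_fin_numE// (le_lt_trans fi)// ltry.
by rewrite sub0r normrN ger0_norm ?fine_ge0// -lee_fin fineK.
Unshelve. all: by end_near. Qed.

Lemma ae_base_gt0 {R : realType} (alpha : \bar R) (P : R -> Prop) :
  (forall t, (0 < t)%R -> base alpha t -> P t) -> ae_base alpha P.
Proof.
move=> H; exists [set 0%R]; split => //; first exact: lebesgue_measure_set1.
move=> t /= Pt; apply: contrapT => t0; apply: Pt => bt; apply: H => //.
by rewrite lt_neqAle bt.1 andbT eq_sym; apply/eqP.
Qed.

(** Up to null sets, the level sets of all [u n] lie in the level set [D] of [x], of finite measure;
    dominated convergence on [D] applies to their indicators. *)
Lemma distr_fun_cvg0 {R : realType} (alpha : \bar R) (x : R -> \bar R)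
    (u : nat -> R -> \bar R) (l : R) : L0 alpha x -> (forall n, L0 alpha (u n)) ->
  (forall n, ae_base alpha (fun t => `|u n t| <= `|x t|)) ->
  ae_base alpha (fun t => u n t @[n --> \oo] --> (0 : \bar R)) ->
  (0 < l)%R -> distr_fun alpha x l < +oo ->
  distr_fun alpha (u n) l @[n --> \oo] --> (0 : \bar R).
Proof.
move=> mx mu_ ux u0 l0 dx.
pose D := base alpha `&` [set s | l%:E < `|x s|].
have mD : measurable D by exact: measurable_level.
pose A n := base alpha `&` [set s | l%:E < `|u n s|].
have mA n : measurable (A n) by exact: measurable_level.
have iD : (@lebesgue_measure R).-integrable D (cst 1).
  apply/integrableP; split => //.
  rewrite (eq_integral (cst 1)) => [|t _]; last by rewrite /cst gee0_abs.
  by rewrite integral_cst// mul1e.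
have := @dominated_convergence _ _ _ (@lebesgue_measure R) D mD
  (fun n t => (\1_(A n) t)%:E) (cst 0) (cst 1).
case=> //.
- by move=> n; apply/measurable_EFinP; apply: measurable_indic; exact: mA.
- apply: negligibleS u0 => t /= H1 H2; apply: H1 => Dt.
  have /cvg_abse := H2 Dt.1; rewrite abse0 => /ge0_cvge0P cv.
  apply/ge0_cvge0P => [n|e e0]; first by rewrite lee_fin.
  have := cv (fun=> abse_ge0 _) _ l0; apply: filterS => n ul.
  rewrite indic_notin ?lee_fin ?ltW// => -[_ /=].
  by rewrite ltNge ul.
- by apply: aeW => t n _; rewrite gee0_abs ?lee_fin// indicE.
move=> _ _; rewrite integral0 => cv0.
have cv : lebesgue_measure (A n `&` D) @[n --> \oo] --> (0 : \bar R).
  suff <- : (fun n => \int[lebesgue_measure]_(t in D) (\1_(A n) t)%:E) =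
    (fun n => lebesgue_measure (A n `&` D)) by exact: cv0.
  by apply/funext => n; rewrite integral_indic//; exact: mA.
apply/ge0_cvge0P => [n|e e0]; first exact: distr_fun_ge0.
move/ge0_cvge0P : cv => /(_ (fun=> measure_ge0 _ _) e e0); apply: filterS => n.
apply: le_trans.
have [N [mN N0 HN]] := ux n.
rewrite -[leRHS]adde0 -[X in _ <= _ + X]N0.
apply: le_trans (measureU2 (@lebesgue_measure R) (measurableI _ _ (mA n) mD) mN).
apply: le_measure; rewrite ?inE.
- exact: mA.
- by apply: measurableU => //; apply: measurableI => //; exact: mA.
- move=> s [bs /= ls]; have [Ns|Ns] := pselect (N s); [by right|left].
  split; [by split|split => //=]; apply: (lt_le_trans ls).
  by move: bs; apply: contrapT => sxy; apply: Ns; apply: HN.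
Qed.

(** * From K-order continuity to order continuity *)

Section K_order_continuity_implies_order_continuity.
Context {R : realType} (alpha : \bar R).
Hypothesis halpha : alpha = 1%:E \/ alpha = +oo.
Variables (E : set (R -> \bar R)) (nrm : (R -> \bar R) -> R).
Hypothesis hE : symmetric_space alpha E nrm.
Local Notation mu := (@lebesgue_measure R).
Local Notation phi := (fundamental_fun nrm).
Local Notation "x ^*" := (decr_rearr alpha x).
Implicit Types (x y : R -> \bar R) (h l t : R).

Let hB : banach_function_space alpha E nrm := sym_bfs hE.
Let alpha_ge0 : 0 <= alpha := ltW (alpha_gt0 halpha).

(** By monotonicity the limit is an infimum. The witness is asked to be positive so that it can
    serve as the length of an interval. *)
Lemma decr_rearr_infty_eq0 x : alpha = +oo ->
  decr_rearr_infty alpha x = 0 <->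
  (forall e, (0 < e)%R -> exists2 t, (0 < t)%R & x^* t <= e%:E).
Proof.
move=> ay.
have -> : decr_rearr_infty alpha x = ereal_inf (range x^*).
  rewrite /decr_rearr_infty ay eqxx -ay; apply: cvg_lim => //.
  by apply: nonincreasing_cvge; exact: decr_rearr_nonincreasing.
split => [i0 e e0|H].
  have : ereal_inf (range x^*) < e%:E by rewrite i0 lte_fin.
  move=> /ereal_inf_lt[_ [t _ <-] xt]; exists (Num.max t 1)%R.
    by rewrite lt_max ltr01 orbT.
  apply: le_trans (ltW xt); apply: decr_rearr_nonincreasing.
  by rewrite le_max lexx.
apply/eqP; rewrite eq_le; apply/andP; split.
  apply/lee_addgt0Pr => e e0; rewrite add0e.
  have [t _ te] := H _ e0; apply: le_trans te.
  by apply: ereal_inf_lbound; exists t.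
by apply: le_ereal_inf_tmp => _ [t _ <-]; exact: decr_rearr_ge0.
Qed.

Lemma max_fun_ge0 x t : (0 < t)%R -> 0 <= max_fun alpha x t.
Proof.
move=> t0; rewrite /max_fun mule_ge0 ?lee_fin ?invr_ge0 ?(ltW t0)//.
by apply: integral_ge0 => s _; exact: decr_rearr_ge0.
Qed.

Lemma max_fun_le x y t : (0 < t)%R ->
  (max_fun alpha x t <= max_fun alpha y t) =
  (\int[mu]_(s in `[0%R, t]) x^* s <= \int[mu]_(s in `[0%R, t]) y^* s).
Proof. by move=> t0; rewrite /max_fun lee_pmul2l// lte_fin invr_gt0. Qed.

Lemma space_hlp_prec x y : E x -> E y -> (forall t, (0 <= t)%R -> x^* t <= y^* t) ->
  hlp_prec alpha x y.
Proof.
move=> Ex Ey xy; split.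
- exact: (space_L1_plus_Linfty halpha hE Ex).
- exact: (space_L1_plus_Linfty halpha hE Ey).
move=> t t0; rewrite (max_fun_le x y t0); apply: ge0_le_integral => //.
- by move=> s _; exact: decr_rearr_ge0.
- by apply: measurable_funTS; exact: measurable_decr_rearr.
- by apply: measurable_funTS; exact: measurable_decr_rearr.
- by move=> s; rewrite /= in_itv/= => /andP[s0 _]; exact: xy.
Qed.

Lemma K_order_continuity_order_continuity x :
  K_order_continuity_point alpha E nrm x ->
  (alpha = +oo -> decr_rearr_infty alpha x = 0) ->
  order_continuity_point alpha E nrm x.
Proof.
move=> [Ex HK] xinf; split => // u Eu ux u0.
have mx := bfs_L0 hB Ex; have mu_ n := bfs_L0 hB (Eu n).1.
have aux n : ae_base alpha (fun t => `|u n t| <= `|x t|).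
  apply: negligibleS (negligibleU (Eu n).2 (ux n)) => t /= H.
  have [H1|H1] := pselect (base alpha t -> u n t <= `|x t|); [left|by right].
  by move=> H2; apply: H => bt; rewrite gee0_abs ?H1// H2.
(* Convergence in measure needs level sets of finite measure; on an infinite base [x^* t <= l]
   bounds the measure by [t]. *)
have dx l : (0 < l)%R -> distr_fun alpha x l < +oo.
  move=> l0; case: halpha => ay.
    apply: (@le_lt_trans _ _ (mu (base alpha))); last by rewrite measure_base// ay ltry.
    apply: le_measure; rewrite ?inE; [exact: measurable_level|exact: base_measurable|].
    by move=> ? [].
  have [t t0 xt] := (decr_rearr_infty_eq0 x ay).1 (xinf ay) _ l0.
  apply: (@le_lt_trans _ _ t%:E); last exact: ltry.
  by rewrite leNgt -lt_decr_rearr ?(ltW l0)// -leNgt.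
apply: HK => [n|n|].
- exact: (Eu n).1.
- apply: space_hlp_prec => //; first exact: (Eu n).1.
  by move=> t _; exact: (decr_rearr_le _ (mu_ n) mx (aux n)).
apply: ae_base_gt0 => t t0 _.
apply/ge0_cvge0P => [n|e e0]; first exact: decr_rearr_ge0.
have dcv := distr_fun_cvg0 mx mu_ aux u0 e0 (dx _ e0).
have : \forall n \near \oo, distr_fun alpha (u n) e <= t%:E.
  exact: (ge0_cvge0P (fun n => distr_fun_ge0 alpha (u n) e)).1 dcv t t0.
apply: filterS => n.
by rewrite leNgt -lt_decr_rearr ?(ltW e0)// -leNgt.
Qed.

End K_order_continuity_implies_order_continuity.

(** * Decay of the maximal function *)

Section maximal_function_decay.
Context {R : realType} (alpha : \bar R).
Hypothesis halpha : alpha = 1%:E \/ alpha = +oo.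
Variables (E : set (R -> \bar R)) (nrm : (R -> \bar R) -> R).
Hypothesis hE : symmetric_space alpha E nrm.
Local Notation mu := (@lebesgue_measure R).
Local Notation phi := (fundamental_fun nrm).
Local Notation "x ^*" := (decr_rearr alpha x).
Implicit Types (x y : R -> \bar R) (h l t : R).

Let hB : banach_function_space alpha E nrm := sym_bfs hE.

Lemma integral0_decr_rearr_fin x h : E x -> (0 < h)%R -> h%:E <= alpha ->
  \int[mu]_(s in `[0%R, h]) x^* s \is a fin_num.
Proof.
move=> Ex h0 ha; rewrite ge0_fin_numE ?integral0_ge0//; last first.
  exact: decr_rearr_ge0.
by apply: (le_lt_trans (integral0_decr_rearr_le halpha hE Ex h0 ha)); exact: ltry.
Qed.

(** The integral up to [T] is a constant, absorbed by [s * (e / 2)] for large [s]; past [T] the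
    integrand is at most [e / 2]. *)
Lemma integral0_decr_rearr_littleo x : alpha = +oo -> E x ->
  (forall e, (0 < e)%R -> exists2 t, (0 < t)%R & x^* t <= e%:E) ->
  forall e, (0 < e)%R -> exists2 S, (0 < S)%R & forall s, (S <= s)%R ->
    \int[mu]_(r in `[0%R, s]) x^* r <= (s * e)%:E.
Proof.
move=> ay Ex H e e0.
have e20 : (0 < e / 2)%R by rewrite divr_gt0.
have [T T0 xT] := H _ e20.
have KE := integral0_decr_rearr_fin Ex T0 (_ : T%:E <= alpha).
have {}KE := KE (eq_rect_r (fun a => T%:E <= a) (leey T%:E) ay).
pose K := fine (\int[mu]_(s in `[0%R, T]) x^* s).
have K0 : (0 <= K)%R by rewrite fine_ge0// integral0_ge0//; exact: decr_rearr_ge0.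
exists (Num.max T (K / (e / 2)))%R; first by rewrite lt_max T0.
move=> s; rewrite ge_max => /andP[Ts Ks].
rewrite (integral0_split _ _ (ltW T0) Ts); last 2 first.
- exact: decr_rearr_nonincreasing.
- exact: decr_rearr_ge0.
have -> : (s * e)%:E = (s * (e / 2))%:E + (s * (e / 2))%:E.
  by rewrite -EFinD; congr EFin; field.
apply: leeD.
  by rewrite -(fineK KE) lee_fin -ler_pdivrMr.
apply: (le_trans (integral_oc_le _ _ Ts)).
- exact: decr_rearr_nonincreasing.
- exact: decr_rearr_ge0.
apply: (@le_trans _ _ ((s - T)%:E * (e / 2)%:E)).
  by apply: lee_wpmul2l => //; rewrite lee_fin subr_ge0.
by rewrite -EFinM lee_fin ler_wpM2r ?(ltW e20)// gerBl ltW.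
Qed.

Lemma decr_rearr_indic_le (c h t : R) : alpha = +oo -> (0 <= c)%R -> (0 < h)%R ->
  (0 <= t)%R ->
  (fun s => c%:E * (\1_(`]0%R, h[%classic) s)%:E)^* t <= (if (t < h)%R then c else 0%R)%:E.
Proof.
move=> ay c0 h0 t0; apply: ge0_le_ereal => [|l].
  by rewrite lee_fin; case: ifP.
have [l0|l0 _] := leP 0%R l; last first.
  by rewrite lee_fin (le_trans (ltW l0))//; case: ifP.
rewrite lt_decr_rearr//; last exact: L0_indic.
rewrite distr_fun_indic//; last first.
  by move=> s; rewrite /= in_itv/= => /andP[s0 _]; split; [exact: ltW|rewrite ay ltry].
rewrite lebesgue_measure_itv/= lte_fin h0 oppr0 adde0 ger0_norm//.
case: ifPn => lc; last by rewrite lte_fin ltNge t0.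
by rewrite lte_fin => ->; rewrite lee_fin ltW.
Qed.

Lemma max_fun_fin x h : alpha = +oo -> E x -> (0 < h)%R ->
  (h * fine (max_fun alpha x h))%:E = \int[mu]_(s in `[0%R, h]) x^* s.
Proof.
move=> ay Ex h0.
have XE : \int[mu]_(s in `[0%R, h]) x^* s \is a fin_num.
  by apply: integral0_decr_rearr_fin => //; rewrite ay leey.
rewrite /max_fun -(fineK XE) -EFinM /= mulrA divff ?mul1r//.
by rewrite gt_eqF.
Qed.

(** Replacing [x^*] by its mean on [[0, h]] and by 0 afterwards lowers all primitives: means of
    [x^*] over shorter intervals are larger, and after [h] the primitive of [u^*] stays below the
    integral of [x^*] over [[0, h]]. *)
Lemma mean_indic_hlp_prec x (h : R) : alpha = +oo -> E x -> (0 < h)%R ->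
  let c := fine (max_fun alpha x h) in
  let u := fun s => c%:E * (\1_(`]0%R, h[%classic) s)%:E in
  E u /\ hlp_prec alpha u x.
Proof.
move=> ay Ex h0 c u.
have ha a : a%:E <= alpha by rewrite ay leey.
have c0 : (0 <= c)%R by rewrite fine_ge0// max_fun_ge0.
have Eu : E u.
  by apply: (bfs_scale hB); exact: (fundamental_funE halpha hE h0 (ha h)).1.
split; first exact: Eu.
split.
- exact: (space_L1_plus_Linfty halpha hE Eu).
- exact: (space_L1_plus_Linfty halpha hE Ex).
move=> t t0; rewrite (max_fun_le alpha u x t0).
have u_ni := @decr_rearr_nonincreasing _ alpha u.
have u_ge0 := decr_rearr_ge0 alpha u.
have u_le s : (0 <= s)%R -> u^* s <= (if (s < h)%R then c else 0%R)%:E.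
  by move=> s0; exact: decr_rearr_indic_le.
have u_int s : (0 <= s)%R -> \int[mu]_(r in `[0%R, s]) u^* r <= (s * c)%:E.
  move=> s0; apply: (@le_trans _ _ (\int[mu]_(r in `[0%R, s]) cst c%:E r)).
    apply: ge0_le_integral => //.
    - exact: (measurable_funTS (measurable_decr_rearr alpha u)).
    - move=> r; rewrite /= in_itv/= => /andP[r0 _]; apply: (le_trans (u_le _ r0)).
      by rewrite lee_fin; case: ifP.
  rewrite integral_cst//= lebesgue_measure_itv/= lte_fin.
  case: ifPn => s0'; first by rewrite oppr0 adde0 -EFinM mulrC.
  by rewrite mule0 lee_fin mulr_ge0.
have x_ni := @decr_rearr_nonincreasing _ alpha x.
have x_ge0 := decr_rearr_ge0 alpha x.
have [th|/ltW ht] := leP t h.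
  apply: (le_trans (u_int _ (ltW t0))).
  have := integral0_average_le x_ni x_ge0 (ltW t0) th.
  rewrite -max_fun_fin// muleC -EFinM => H.
  rewrite -(@lee_pmul2l _ h%:E)// -EFinM; apply: le_trans H.
  by rewrite lee_fin le_eqVlt; apply/orP; left; apply/eqP; rewrite /c; ring.
rewrite (integral0_split u_ni u_ge0 (ltW h0) ht).
apply: (@le_trans _ _ (\int[mu]_(r in `[0%R, h]) x^* r)); last first.
  exact: (le_integral0 x_ni x_ge0 (ltW h0) ht).
rewrite -(max_fun_fin ay Ex h0) -[leRHS]adde0; apply: leeD; first exact: u_int (ltW h0).
apply: (le_trans (integral_oc_le u_ni u_ge0 ht)).
rewrite mule_ge0_le0 ?lee_fin ?subr_ge0//.
by apply: (le_trans (u_le _ (ltW h0))); rewrite ltxx.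
Qed.

Lemma K_order_continuity_maximal x : alpha = +oo ->
  K_order_continuity_point alpha E nrm x -> decr_rearr_infty alpha x = 0 ->
  (phi s)%:E * max_fun alpha x s @[s --> +oo%R] --> (0 : \bar R).
Proof.
move=> ay [Ex HK] xinf.
have ha a : a%:E <= alpha by rewrite ay leey.
have x0 := integral0_decr_rearr_littleo ay Ex ((decr_rearr_infty_eq0 x ay).1 xinf).
(* The convergence criterion wants a function that is nonnegative everywhere; truncating at 0
   changes nothing for [s > 0]. *)
pose F s := maxe 0 ((phi s)%:E * max_fun alpha x s).
have FE s : (0 < s)%R -> F s = (phi s)%:E * max_fun alpha x s.
  move=> s0; rewrite /F max_r// mule_ge0 ?max_fun_ge0// lee_fin ltW//.
  exact: (fundamental_fun_gt0 halpha hE).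
suff F0 : F s @[s --> +oo%R] --> (0 : \bar R).
  apply: cvg_trans F0; apply: near_eq_cvg.
  have : \forall s \near +oo%R, (0 < s :> R)%R by exact: nbhs_pinfty_gt.
  by apply: filterS => s s0; rewrite FE.
apply/ge0_cvge0P => [s|e e0]; first by rewrite /F le_max lexx.
have [S HS] : exists S : R, forall s, (S < s)%R -> (0 < s)%R -> F s <= e%:E.
  apply: contrapT => H.
  (* K-order continuity speaks of sequences, so a failure of the limit along the reals is turned
     into points [s n] tending to infinity. *)
  have /choice[s Hs] n : exists s, [/\ (n.+1%:R < s)%R, (0 < s)%R & e%:E < F s].
    apply: contrapT => Hn; apply: H; exists n.+1%:R => s ns s0.
    by rewrite leNgt; apply/negP => es; apply: Hn; exists s.
  have s0 n : (0 < s n)%R by have [] := Hs n.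
  pose c n := fine (max_fun alpha x (s n)).
  have c0 n : (0 <= c n)%R by rewrite fine_ge0// max_fun_ge0.
  pose u n := fun r => (c n)%:E * (\1_(`]0%R, s n[%classic) r)%:E.
  have Eu n : E (u n) /\ hlp_prec alpha (u n) x by exact: mean_indic_hlp_prec.
  have nu n : nrm (u n) = (c n * phi (s n))%R.
    rewrite (bfs_norm_scale hB _ (fundamental_funE halpha hE (s0 n) (ha _)).1).
    by rewrite ger0_norm.
  have nue n : (e < nrm (u n))%R.
    have [_ _] := Hs n; rewrite FE// /max_fun -(max_fun_fin ay Ex (s0 n)) -!EFinM.
    rewrite lte_fin nu -/(c n) [(_^-1 * _)%R]mulrA mulVf ?gt_eqF// mul1r.
    by rewrite mulrC.
  have : nrm (u n) @[n --> \oo] --> (0 : R)%R.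
    apply: HK => [n|n|]; [exact: (Eu n).1|exact: (Eu n).2|].
    apply: ae_base_gt0 => t t0 _.
    apply/ge0_cvge0P => [n|d d0]; first exact: decr_rearr_ge0.
    have [S S0 HS] := x0 _ d0.
    (* The rearrangement of [u n] is bounded by its height [c n], the mean of [x^*] over [[0, s n]],
       which tends to 0. *)
    near=> n; apply: (@le_trans _ _ (c n)%:E).
      apply: (le_trans (decr_rearr_indic_le ay (c0 n) (s0 n) (ltW t0))).
      by rewrite lee_fin; case: ifP.
    have Sn : (S <= s n)%R.
      have [ns _ _] := Hs n; apply: le_trans (ltW ns).
      near: n; exists (Num.truncn S) => // n /= Sn.
      by rewrite (le_trans (ltW (truncnS_gt S)))// ler_nat ltnS.
    have := HS _ Sn; rewrite -(max_fun_fin ay Ex (s0 n)) !lee_fin.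
    by rewrite ler_pM2l.
  move=> /cvgrPdist_lt/(_ _ e0)[n _ /(_ n (leqnn _))] /=.
  rewrite sub0r normrN ger0_norm ?(norm_ge0 hE (Eu n).1)//.
  by rewrite ltNge (ltW (nue n)).
near=> s; by apply: HS; near: s; exact: (nbhs_pinfty_gt (num_real _)).
Unshelve. all: by end_near. Qed.

End maximal_function_decay.

(** * Truncations and small subsets of level sets *)

Section truncations.
Context {R : realType} (alpha : \bar R).
Hypothesis halpha : alpha = 1%:E \/ alpha = +oo.
Variables (E : set (R -> \bar R)) (nrm : (R -> \bar R) -> R).
Hypothesis hE : symmetric_space alpha E nrm.
Local Notation mu := (@lebesgue_measure R).
Local Notation phi := (fundamental_fun nrm).
Local Notation "x ^*" := (decr_rearr alpha x).
Implicit Types (x y : R -> \bar R) (h l t M : R).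

Let hB : banach_function_space alpha E nrm := sym_bfs hE.
Let alpha_ge0 : 0 <= alpha := ltW (alpha_gt0 halpha).

Definition excess M x t := maxe (`|x t| - M%:E) 0.
Definition cap M x t := mine `|x t| M%:E.

Lemma excess_ge0 M x t : 0 <= excess M x t.
Proof. by rewrite le_max lexx orbT. Qed.

Lemma cap_ge0 M x t : (0 <= M)%R -> 0 <= cap M x t.
Proof. by move=> M0; rewrite le_min abse_ge0 lee_fin. Qed.

Lemma L0_excess M x : L0 alpha x -> L0 alpha (excess M x).
Proof.
move=> mx; apply: measurable_maxe => //.
by apply: emeasurable_funB => //; exact: measurableT_comp.
Qed.

Lemma L0_cap M x : L0 alpha x -> L0 alpha (cap M x).
Proof.
by move=> mx; apply: measurable_mine => //; exact: measurableT_comp.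
Qed.

Lemma excess_space M x : (0 <= M)%R -> E x -> E (excess M x).
Proof.
move=> M0 Ex; refine (proj1 (space_le hE (L0_excess _ (bfs_L0 hB Ex)) Ex _)) => t _.
rewrite gee0_abs ?excess_ge0// ge_max abse_ge0 andbT.
by rewrite leeBlDr// leeDl// lee_fin.
Qed.

Lemma cap_space M x : (0 <= M)%R -> E x -> E (cap M x).
Proof.
move=> M0 Ex; refine (proj1 (space_le hE (L0_cap _ (bfs_L0 hB Ex)) Ex _)) => t _.
by rewrite gee0_abs ?cap_ge0// ge_min lexx.
Qed.

Lemma distr_excess M x l : (0 <= M)%R -> (0 <= l)%R ->
  distr_fun alpha (excess M x) l = distr_fun alpha x (l + M).
Proof.
move=> M0 l0; rewrite /distr_fun; congr (mu (_ `&` _)); apply/seteqP.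
have H s : (l%:E < `|excess M x s|) = ((l + M)%:E < `|x s|).
  rewrite gee0_abs ?excess_ge0// lt_max [_ < 0]lte_fin [(l < 0)%R]ltNge l0 orbF.
  by rewrite lteBrDr.
by split => s; rewrite /mkset H.
Qed.

Lemma distr_cap M x l : (0 <= M)%R -> (0 <= l)%R ->
  distr_fun alpha (cap M x) l = if (l < M)%R then distr_fun alpha x l else 0.
Proof.
move=> M0 l0; rewrite /distr_fun.
have H s : (l%:E < `|cap M x s|) = (l%:E < `|x s|) && (l < M)%R.
  by rewrite gee0_abs ?cap_ge0// lt_min lte_fin.
case: ifPn => lM.
  congr (mu (_ `&` _)); apply/seteqP.
  by split => s; rewrite /mkset H lM andbT.
rewrite [X in mu X](_ : _ = set0) ?measure0// -subset0 => s [_].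
by rewrite /mkset H (negbTE lM) andbF.
Qed.

(** Order continuity is assumed for [x], whereas the estimates concern [x^*]; equimeasurability of
    the truncations transports the norms. *)
Lemma excess_decr_rearr M x : (0 <= M)%R -> E x ->
  E (excess M x^*) /\ nrm (excess M x^*) = nrm (excess M x).
Proof.
move=> M0 Ex; have mx : L0 alpha x := bfs_L0 hB Ex.
apply: (sym_distr hE) (excess_space M0 Ex) _ => [|l l0].
  by apply: L0_excess; apply: L0_nonincreasing; exact: decr_rearr_nonincreasing.
by rewrite !distr_excess// distr_decr_rearr// addr_ge0.
Qed.

Lemma cap_decr_rearr M x : (0 <= M)%R -> E x ->
  E (cap M x^*) /\ nrm (cap M x^*) = nrm (cap M x).
Proof.
move=> M0 Ex; have mx : L0 alpha x := bfs_L0 hB Ex.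
apply: (sym_distr hE) (cap_space M0 Ex) _ => [|l l0].
  by apply: L0_cap; apply: L0_nonincreasing; exact: decr_rearr_nonincreasing.
by rewrite !distr_cap// distr_decr_rearr.
Qed.

Lemma norm_excess_cvg0 x : order_continuity_point alpha E nrm x ->
  nrm (excess n%:R x) @[n --> \oo] --> (0 : R)%R.
Proof.
move=> [Ex Hx]; apply: Hx => [n|n|].
- split; first exact: excess_space.
  by apply: ae_baseW => t _; exact: excess_ge0.
- apply: ae_baseW => t _; rewrite ge_max abse_ge0 andbT.
  by rewrite leeBlDr// leeDl// lee_fin.
apply: negligibleS (space_ae_finite hE Ex) => t /= H1 H2; apply: H1 => bt.
have {}H2 := H2 bt; have xfin : `|x t| \is a fin_num by rewrite ge0_fin_numE.
apply/ge0_cvge0P => [n|e e0]; first exact: excess_ge0.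
exists (Num.truncn (fine `|x t|)).+1 => // n /= tn.
rewrite ge_max lee_fin (ltW e0) andbT leeBlDr//.
rewrite -(fineK xfin) -EFinD lee_fin (le_trans (ltW (truncnS_gt _)))//.
by apply: (@le_trans _ _ (n%:R : R)%R); rewrite ?ler_nat// lerDr ltW.
Qed.

Lemma norm_cap_cvg0 x : order_continuity_point alpha E nrm x ->
  nrm (cap n.+1%:R^-1 x) @[n --> \oo] --> (0 : R)%R.
Proof.
move=> [Ex Hx]; apply: Hx => [n|n|].
- split; first exact: cap_space.
  by apply: ae_baseW => t _; exact: cap_ge0.
- by apply: ae_baseW => t _; rewrite ge_min lexx.
apply: ae_baseW => t _; apply/ge0_cvge0P => [n|e e0]; first exact: cap_ge0.
have [n ne] := exists_natSinv_lt e0; exists n => // m /= nm.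
rewrite ge_min lee_fin (le_trans _ (ltW ne)) ?orbT//.
by rewrite lef_pV2 ?posrE// ler_nat.
Qed.

(* The [B n] are the traces of the level set on [[0, r0 + 1/(n+1))], where [r0] is the largest
   [r] for which its trace on [[0, r)] is negligible. *)
Lemma exists_small_level_set x (c : R) : L0 alpha x -> 0 < distr_fun alpha x c ->
  exists B : nat -> set R, [/\ forall n, measurable (B n),
    forall n, B n `<=` base alpha `&` [set s | c%:E < `|x s|],
    forall n, 0 < mu (B n) < +oo &
    ae_base alpha (fun t => \forall n \near \oo, ~ B n t)].
Proof.
move=> mx dc; pose A := base alpha `&` [set s | c%:E < `|x s|].
have mA : measurable A by exact: measurable_level.
pose I r := A `&` `[0%R, r[%classic.
have mI r : measurable (I r) by apply: measurableI => //; exact: measurable_itv.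
have Ile r s : (r <= s)%R -> I r `<=` I s.
  move=> rs t [At /=]; rewrite in_itv/= => /andP[t0 tr]; split => //=.
  by rewrite in_itv/= t0 (lt_le_trans tr).
pose S := [set r : R | (0 <= r)%R /\ mu (I r) = 0].
have S0 : S 0%R.
  split => //; rewrite /I set_itvco0 ?setI0 ?measure0//.
have Sub : has_ubound S.
  have [n In] : exists n : nat, mu (I n%:R) <> 0.
    apply: contrapT => H; have : mu.-negligible A.
      have nI (n : nat) : mu.-negligible (I n%:R).
        by apply/negligibleP; [exact: mI|apply: contrapT => In; apply: H; exists n].
      apply: negligibleS (negligible_bigcup nI) => t At.
      exists (Num.truncn t).+1 => //; split => //=; rewrite in_itv/=.
      by rewrite At.1.1 truncnS_gt.
    by move/negligibleP => /(_ mA) A0; move: dc; rewrite /distr_fun A0 ltxx.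
  exists n%:R => r [r0 Ir]; rewrite leNgt; apply/negP => nr; apply: In.
  by apply: subset_measure0 Ir; [exact: mI|exact: mI|apply: Ile; exact: ltW].
(* The traces on [[0, 1/(n+1))] could all be negligible, hence the shift of the right ends by
   [r0]. *)
pose r0 := sup S.
have supS : has_sup S by split => //; exists 0%R.
have r00 : (0 <= r0)%R by apply: ub_le_sup.
have Ir0 : mu.-negligible (I r0).
  have /choice[q Hq] n : exists q, S q /\ (r0 - n.+1%:R^-1 < q)%R.
    have n0 : (0 < n.+1%:R^-1 :> R)%R by rewrite invr_gt0.
    have [q Sq rq] := sup_adherent n0 supS.
    by exists q.
  have nI n : mu.-negligible (I (q n)) by apply/negligibleP; [exact: mI|exact: (Hq n).1.2].
  apply: negligibleS (negligible_bigcup nI) => t [At /=].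
  rewrite in_itv/= => /andP[t0 tr].
  have rt0 : (0 < r0 - t)%R by rewrite subr_gt0.
  have [n nt] := exists_natSinv_lt rt0; exists n => //; split => //=.
  rewrite in_itv/= t0 (lt_trans _ (Hq n).2)//.
  by rewrite ltrBrDl -ltrBrDr.
exists (fun n => I (r0 + n.+1%:R^-1)%R); split => //.
- by move=> n t [].
- move=> n; apply/andP; split.
    rewrite lt_neqAle measure_ge0 andbT eq_sym; apply/eqP => I0.
    have : S (r0 + n.+1%:R^-1)%R by split => //; rewrite addr_ge0.
    by move=> /(ub_le_sup Sub); rewrite leNgt ltrDl invr_gt0 ltr0Sn.
  apply: (@le_lt_trans _ _ (mu `[0%R, (r0 + n.+1%:R^-1)%R[%classic)).
    by apply: le_measure; rewrite ?inE//; [exact: mI|move=> t []].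
  by rewrite lebesgue_measure_itv/=; case: ifP; rewrite -?EFinB ltry.
- have n1 : mu.-negligible [set r0].
    by apply/negligibleP => //; exact: lebesgue_measure_set1.
  apply: negligibleS (negligibleU Ir0 n1) => t /= H.
  apply: contrapT => /not_orP[It tr0]; apply: H => bt.
  have [At|At] := pselect (A t); last by exists 0%N => // n _ [].
  have rt : (r0 < t)%R.
    rewrite lt_neqAle; apply/andP; split; first by rewrite eq_sym; apply/eqP.
    by rewrite leNgt; apply/negP => tr; apply: It; split => //=; rewrite in_itv/= bt.1.
  have tr : (0 < t - r0)%R by rewrite subr_gt0.
  have [n nt] := exists_natSinv_lt tr; exists n => // m /= nm [_ /=].
  rewrite in_itv/= => /andP[_]; rewrite ltNge -lerBrDl (le_trans _ (ltW nt))//.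
  by rewrite lef_pV2 ?posrE// ler_nat.
Qed.

End truncations.

(** * From order continuity to K-order continuity *)

Section order_continuity_implies_K_order_continuity.
Context {R : realType} (alpha : \bar R).
Hypothesis halpha : alpha = 1%:E \/ alpha = +oo.
Variables (E : set (R -> \bar R)) (nrm : (R -> \bar R) -> R).
Hypothesis hE : symmetric_space alpha E nrm.
Hypothesis hF : fatou_property alpha E nrm.
Local Notation mu := (@lebesgue_measure R).
Local Notation phi := (fundamental_fun nrm).
Local Notation rearr := (decr_rearr alpha).
Implicit Types (x y : R -> \bar R) (h l t M : R).

Let hB : banach_function_space alpha E nrm := sym_bfs hE.
Let alpha_ge0 : 0 <= alpha := ltW (alpha_gt0 halpha).

Definition cut h (f : R -> \bar R) t : \bar R := if (t < h)%R then f t else 0.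

(** With [c = x^**(h)] and [f = x^*], this averages [x^*] over [[0, h)]: it stays nonincreasing
    because [x^*(h) <= x^**(h)], and its primitive is unchanged from [h] on. *)
Definition plateau (c : \bar R) h (f : R -> \bar R) t : \bar R :=
  if (t < h)%R then c else f t.

Lemma cut_ni h x : {homo cut h (rearr x) : s t / (s <= t)%R >-> t <= s}.
Proof.
move=> s t st; rewrite /cut; case: ifPn => th.
  by rewrite (le_lt_trans st th) decr_rearr_nonincreasing.
by case: ifP => // _; exact: decr_rearr_ge0.
Qed.

Lemma cut_ge0 h x t : 0 <= cut h (rearr x) t.
Proof. by rewrite /cut; case: ifP => // _; exact: decr_rearr_ge0. Qed.

Lemma plateau_ni c h x : rearr x h <= c ->
  {homo plateau c h (rearr x) : s t / (s <= t)%R >-> t <= s}.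
Proof.
move=> xc s t st; rewrite /plateau; case: ifPn => th.
  by rewrite (le_lt_trans st th).
case: ifPn => sh; last exact: decr_rearr_nonincreasing.
by apply: le_trans xc; apply: decr_rearr_nonincreasing; rewrite leNgt.
Qed.

Lemma plateau_ge0 c h x t : 0 <= c -> 0 <= plateau c h (rearr x) t.
Proof. by move=> c0; rewrite /plateau; case: ifP => // _; exact: decr_rearr_ge0. Qed.

(** A remainder of height [c] on an initial interval costs [c * phi h]; this is how [phi] enters the
    estimates. *)
Lemma norm_le_add_indic x y (c h : R) : E y -> (0 <= c)%R -> (0 < h)%R ->
  h%:E <= alpha -> L0 alpha x -> (forall t, 0 <= x t) -> (forall t, 0 <= y t) ->
  (forall t, base alpha t -> (0 < t)%R ->
     x t <= y t + (if (t < h)%R then c else 0%R)%:E) ->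
  E x /\ (nrm x <= nrm y + c * phi h)%R.
Proof.
move=> Ey c0 h0 ha mx x0 y0 xy.
have Eh := (fundamental_funE halpha hE h0 ha).1.
have -> : (c * phi h = nrm (fun t => c%:E * (\1_(`]0%R, h[%classic) t)%:E)%E)%R.
  by rewrite (bfs_norm_scale hB _ Eh) ger0_norm.
have Ech := bfs_scale hB c Eh.
have H : E x /\ (nrm x <= nrm (fun t => y t + c%:E * (\1_(`]0%R, h[%classic) t)%:E)%E)%R.
  apply: (bfs_ideal hB) => //; first exact: (bfs_add hB).
  apply: ae_base_gt0 => t t0 bt; rewrite !gee0_abs//; last first.
    by rewrite adde_ge0// mule_ge0// lee_fin.
  apply: (le_trans (xy _ bt t0)); apply: leeD => //; case: ifPn => th.
    by rewrite indic_in ?mule1//= in_itv/= t0.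
  by rewrite mule_ge0// lee_fin.
split; first exact: H.1.
by apply: (le_trans H.2); exact: (bfs_norm_triangle hB).
Qed.

(** Order continuity is applied to multiples of indicators of subsets [B k] of a level set of [x].
    These shrink to a null set but have positive measure, and symmetry identifies the norm of such
    an indicator with [phi] at that measure. *)
Lemma fundamental_fun_small x e : order_continuity_point alpha E nrm x ->
  ~ ae_base alpha (fun t => x t = 0) -> (0 < e)%R ->
  exists2 d, (0 < d)%R /\ d%:E <= alpha & (phi d <= e)%R.
Proof.
move=> [Ex Hx] xN0 e0; have mx : L0 alpha x := bfs_L0 hB Ex.
have [n dn] : exists n, 0 < distr_fun alpha x n.+1%:R^-1.
  apply: contrapT => H; apply: xN0; apply: ae_eq0_levels => // n.
  apply/eqP; rewrite eq_le distr_fun_ge0 andbT leNgt; apply/negP => ?.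
  by apply: H; exists n.
have [B [mB BA B0 Bcvg]] := exists_small_level_set mx dn.
set c : R := (n.+1%:R^-1)%R in dn BA.
have c0 : (0 < c)%R by rewrite invr_gt0.
pose u k t : \bar R := c%:E * (\1_(B k) t)%:E.
have u0 k t : 0 <= u k t by rewrite /u mule_ge0// lee_fin// ltW.
have ux k t : u k t <= `|x t|.
  rewrite /u; have [Bt|Bt] := pselect (B k t); last by rewrite indic_notin// mule0.
  by rewrite indic_in// mule1 ltW//; have [] := BA k t Bt.
have Eu k : E (u k).
  refine (proj1 (space_le hE _ Ex _)) => [|t _]; first exact: L0_indic.
  by rewrite gee0_abs.
have EB k : E (fun t => (\1_(B k) t)%:E).
  rewrite (_ : (fun _ => _) = (fun t => (c^-1)%:E * u k t)); last first.
    by apply/funext => t; rewrite /u -!EFinM mulrA mulVf ?gt_eqF// mul1r.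
  exact: (bfs_scale hB).
have nu k : nrm (u k) = (c * nrm (fun t => (\1_(B k) t)%:E))%R.
  by rewrite (bfs_norm_scale hB _ (EB k)) gtr0_norm.
have : nrm (u k) @[k --> \oo] --> (0 : R)%R.
  apply: Hx => [k|k|].
  - by split => //; exact: ae_baseW.
  - by apply: ae_baseW => t _; exact: ux.
  apply: negligibleS Bcvg => t /= H1 H2; apply: H1 => bt.
  apply/ge0_cvge0P => // d d0; have := H2 bt; apply: filterS => k Bk.
  by rewrite /u indic_notin// mule0 lee_fin ltW.
have ce : (0 < c * e)%R by rewrite mulr_gt0.
move=> /cvgrPdist_lt/(_ _ ce)[k _ /(_ k (leqnn _))] /=.
rewrite sub0r normrN ger0_norm ?(norm_ge0 hE (Eu k))// nu ltr_pM2l// => Be.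
have /andP[Bk0 Bky] := B0 k.
have Bfin : mu (B k) \is a fin_num by rewrite ge0_fin_numE// ltW.
pose d := fine (mu (B k)).
have dE : d%:E = mu (B k) by rewrite fineK.
have d0 : (0 < d)%R by rewrite -lte_fin dE.
have Bb : B k `<=` base alpha by move=> t /(BA k)[].
have da : d%:E <= alpha.
  rewrite dE -[leRHS]measure_base//; apply: le_measure; rewrite ?inE//.
    exact: mB.
  exact: base_measurable.
exists d => //; apply: le_trans (ltW Be).
rewrite (fundamental_funE halpha hE d0 da).2 -base_fin.
have sub : base d%:E `<=` base alpha.
  by move=> t [t0 td]; split => //; exact: lt_le_trans da.
rewrite (indic_equimeasurable hE (mB k) (base_measurable _) Bb sub _ (EB k)).2//.
by rewrite measure_base -?dE// lee_fin ltW.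
Qed.

Lemma norm_cut_small x e : order_continuity_point alpha E nrm x -> (0 < e)%R ->
  exists2 d, (0 < d)%R /\ d%:E <= alpha & E (cut d (rearr x)) /\ (nrm (cut d (rearr x)) <= e)%R.
Proof.
move=> ocx e0; have Ex := ocx.1; have [Ex' nx'] := space_decr_rearr halpha hE Ex.
have L0cut d : L0 alpha (cut d (rearr x)) by apply: L0_nonincreasing; exact: cut_ni.
(* If [x] vanishes a.e., nothing can be said of [phi] near 0, but the norm is 0 and [d = 1]
   serves. *)
have [x0|x0] := pselect (ae_base alpha (fun t => x t = 0)).
  exists 1%R; first by split => //; case: halpha => ->; rewrite ?leey.
  have [Ec nc] : E (cut 1%R (rearr x)) /\ (nrm (cut 1%R (rearr x)) <= nrm (rearr x))%R.
    apply: (space_le hE) => // t _; rewrite !gee0_abs ?cut_ge0 ?decr_rearr_ge0//.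
    by rewrite /cut; case: ifP => // _; exact: decr_rearr_ge0.
  split => //; apply: (le_trans nc); rewrite nx'.
  have : (nrm x <= nrm (fun t => 0%:E * x t)%E)%R.
    refine (proj2 (bfs_ideal hB (bfs_L0 hB Ex) (bfs_scale hB _ Ex) _)).
    by apply: negligibleS x0 => t /= H1 H2; apply: H1 => bt; rewrite H2// abse0.
  rewrite (bfs_norm_scale hB _ Ex) normr0 mul0r => /le_trans; apply; exact: ltW.
have e20 : (0 < e / 2)%R by rewrite divr_gt0.
have /cvgrPdist_lt/(_ _ e20)[n _ /(_ n (leqnn _))] /= := norm_excess_cvg0 hE ocx.
rewrite sub0r normrN ger0_norm ?(norm_ge0 hE (excess_space hE (ler0n _ n) Ex))// => ne.
have [Een nen] := excess_decr_rearr halpha hE (ler0n R n) Ex.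
(* The height [n] is fixed before [d] is chosen; dividing by [n.+1] covers [n = 0]. *)
have en0 : (0 < e / 2 / n.+1%:R)%R by rewrite divr_gt0.
have [d [d0 da] phid] := fundamental_fun_small ocx x0 en0.
exists d => //.
have [|Ec nc] := norm_le_add_indic Een (ler0n R n) d0 da (L0cut d) (cut_ge0 d x)
  (excess_ge0 _ _).
  move=> t bt t0; rewrite /cut; case: ifPn => td; last by rewrite adde0 excess_ge0.
  rewrite -leeBlDr// le_max gee0_abs ?decr_rearr_ge0// lexx //.
split => //; apply: (le_trans nc); rewrite nen (splitr e) lerD// ?(ltW ne)//.
apply: (@le_trans _ _ (n.+1%:R * (e / 2 / n.+1%:R))%R).
  by apply: ler_pM => //; rewrite ?ler_nat// ltW// (fundamental_fun_gt0 halpha hE).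
by rewrite mulrC divfK.
Qed.

Lemma decr_rearr_le_max_fun x h : (0 < h)%R -> rearr x h <= max_fun alpha x h.
Proof.
move=> h0; rewrite -(@lee_pmul2l _ h%:E)// ?lte_fin// /max_fun muleA -EFinM.
rewrite mulfV ?gt_eqF// mul1e; apply: integral0_ge (ltW h0).
  exact: decr_rearr_nonincreasing.
exact: decr_rearr_ge0.
Qed.

Lemma small_maximal x t e :
  (phi s)%:E * max_fun alpha x s @[s --> +oo%R] --> (0 : \bar R) -> (0 < e)%R ->
  exists T, [/\ (0 < T)%R, (t <= T)%R & (phi T)%:E * max_fun alpha x T <= e%:E].
Proof.
move=> /cvg_abse; rewrite abse0 => phix e0.
have [M [_ HM]] := (ge0_cvge0P (fun=> abse_ge0 _)).1 phix e e0.
exists (Num.max (Num.max t 1) (M + 1))%R; split.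
- by rewrite !lt_max ltr01 orbT.
- by rewrite !le_max lexx.
- by apply: (le_trans (lee_abs _)); apply: HM; rewrite lt_max ltrDl ltr01 orbT.
Qed.

Lemma decr_rearr_infty_of_maximal x : alpha = +oo ->
  (phi s)%:E * max_fun alpha x s @[s --> +oo%R] --> (0 : \bar R) ->
  decr_rearr_infty alpha x = 0.
Proof.
move=> ay phix; apply/(decr_rearr_infty_eq0 x ay) => e e0.
have ha a : a%:E <= alpha by rewrite ay leey.
have phi1 := fundamental_fun_gt0 halpha hE ltr01 (ha _).
have pe : (0 < phi 1 * e)%R by rewrite mulr_gt0.
have [T [T0 T1 HT]] := small_maximal 1%R phix pe.
exists T => //; rewrite -(@lee_pmul2l _ (phi 1)%:E)// ?lte_fin// -EFinM.
apply: le_trans HT; apply: lee_pmul => //.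
- by rewrite lee_fin ltW.
- exact: decr_rearr_ge0.
- by rewrite lee_fin (le_fundamental_fun halpha hE).
- exact: decr_rearr_le_max_fun.
Qed.

(** [T] is taken beyond a point where [x^* <= c], so the plateau is at most [min (x^*, c)] plus a
    block of height [x^**(T)] on [[0, T)], whose norm is [phi(T) x^**(T)]. *)
Lemma norm_plateau_small x e : alpha = +oo -> order_continuity_point alpha E nrm x ->
  (phi s)%:E * max_fun alpha x s @[s --> +oo%R] --> (0 : \bar R) ->
  decr_rearr_infty alpha x = 0 -> (0 < e)%R ->
  exists2 T, (0 < T)%R &
    E (plateau (max_fun alpha x T) T (rearr x)) /\
    (nrm (plateau (max_fun alpha x T) T (rearr x)) <= e)%R.
Proof.
move=> ay ocx phix xinf e0; have Ex := ocx.1.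
have ha a : a%:E <= alpha by rewrite ay leey.
have e20 : (0 < e / 2)%R by rewrite divr_gt0.
have /cvgrPdist_lt/(_ _ e20)[n _ /(_ n (leqnn _))] /= := norm_cap_cvg0 hE ocx.
set c : R := (n.+1%:R^-1)%R.
have c0 : (0 < c)%R by rewrite invr_gt0.
rewrite sub0r normrN ger0_norm ?(norm_ge0 hE (cap_space hE (ltW c0) Ex))// => nc.
have [Ecc ncc] := cap_decr_rearr halpha hE (ltW c0) Ex.
have [t1 t10 xt1] := (decr_rearr_infty_eq0 x ay).1 xinf _ c0.
have [T [T0 t1T phiT]] := small_maximal t1 phix e20.
exists T => //; have XE := max_fun_fin halpha hE ay Ex T0.
have mE : max_fun alpha x T = (fine (max_fun alpha x T))%:E.
  by rewrite {1}/max_fun -XE -EFinM mulrA mulVf ?mul1r// gt_eqF.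
have m0 : (0 <= fine (max_fun alpha x T))%R by rewrite fine_ge0// max_fun_ge0.
have xT := decr_rearr_le_max_fun x T0.
have [||||Ep np] := norm_le_add_indic (x := plateau (max_fun alpha x T) T (rearr x))
    Ecc m0 T0 (ha T).
- by apply: L0_nonincreasing; exact: plateau_ni.
- by move=> t; apply: plateau_ge0; exact: max_fun_ge0.
- by move=> t; apply: cap_ge0; exact: ltW.
- move=> t bt t0; rewrite /plateau; case: ifPn => tT.
    by rewrite -mE leeDr// cap_ge0// ltW.
  rewrite adde0 le_min gee0_abs ?decr_rearr_ge0// lexx/=; apply: le_trans xt1.
  by apply: decr_rearr_nonincreasing; apply: (le_trans t1T); rewrite leNgt.
split => //; apply: (le_trans np); rewrite ncc (splitr e) lerD ?(ltW nc)//.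
by rewrite -lee_fin mulrC EFinM -mE.
Qed.

Lemma integral0_cut h t x : (0 < h)%R -> (0 <= t)%R ->
  \int[mu]_(s in `[0%R, t]) cut h (rearr x) s =
  \int[mu]_(s in `[0%R, Num.min t h]) rearr x s.
Proof.
move=> h0 t0; have [th|ht] := ltP t h.
  apply: eq_integral => s; rewrite inE/= in_itv/= => /andP[_ st].
  by rewrite /cut (le_lt_trans st).
rewrite (integral0_split (@cut_ni h x) (@cut_ge0 h x) (ltW h0) ht).
rewrite [X in _ + X](eq_integral (cst 0)) ?integral0 ?adde0; last first.
  move=> s; rewrite inE/= in_itv/= => /andP[hs _].
  by rewrite /cut ltNge (ltW hs).
rewrite -integral_itv_bndo_bndc; last first.
  exact: (measurable_funTS (nonincreasing_emeasurable (@cut_ni h x))).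
rewrite -integral_itv_bndo_bndc; last first.
  exact: (measurable_funTS (measurable_decr_rearr alpha x)).
apply: eq_integral => s; rewrite inE/= in_itv/= => /andP[_ sh].
by rewrite /cut sh.
Qed.

Lemma integral0_plateau h t x : alpha = +oo -> E x -> (0 < h)%R -> (h <= t)%R ->
  \int[mu]_(s in `[0%R, t]) plateau (max_fun alpha x h) h (rearr x) s =
  \int[mu]_(s in `[0%R, t]) rearr x s.
Proof.
move=> ay Ex h0 ht; have xh := decr_rearr_le_max_fun x h0.
rewrite (integral0_split (plateau_ni xh) _ (ltW h0) ht); last first.
  by move=> s; apply: plateau_ge0; exact: max_fun_ge0.
rewrite (integral0_split (@decr_rearr_nonincreasing _ alpha x)
  (decr_rearr_ge0 alpha x) (ltW h0) ht); congr (_ + _); last first.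
  apply: eq_integral => s; rewrite inE/= in_itv/= => /andP[hs _].
  by rewrite /plateau ltNge (ltW hs).
rewrite -integral_itv_bndo_bndc; last first.
  exact: (measurable_funTS (nonincreasing_emeasurable (plateau_ni xh))).
rewrite (eq_integral (cst (max_fun alpha x h))); last first.
  move=> s; rewrite inE/= in_itv/= => /andP[_ sh].
  by rewrite /plateau sh.
rewrite integral_cst//= lebesgue_measure_itv/= lte_fin h0 oppr0 adde0.
by rewrite /max_fun muleAC -EFinM mulVf ?gt_eqF// mul1e.
Qed.

Let prec_integral x y : hlp_prec alpha x y -> forall t, (0 < t)%R ->
  \int[mu]_(s in `[0%R, t]) rearr x s <= \int[mu]_(s in `[0%R, t]) rearr y s.
Proof. by move=> [_ _ xy] t t0; have := xy t t0; rewrite max_fun_le. Qed.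

Lemma norm_cut_prec h x u : (0 < h)%R -> E u -> E (cut h (rearr x)) ->
  hlp_prec alpha u x ->
  E (cut h (rearr u)) /\ (nrm (cut h (rearr u)) <= 2 * nrm (cut h (rearr x)))%R.
Proof.
move=> h0 Eu Ec ux; apply: (norm_le_of_integral_le halpha hE hF Ec).
- exact: cut_ni.
- exact: cut_ge0.
- exact: cut_ni.
- exact: cut_ge0.
- move=> t l; rewrite {1}/cut; case: ifPn => th lu.
    have [s ts ls] := decr_rearr_right_continuous (bfs_L0 hB Eu) lu.
    (* The midpoint keeps the new argument below [h], where [cut] still agrees with the
       rearrangement. *)
    exists (Num.min s ((t + h) / 2))%R; first by rewrite lt_min ts midf_lt.
    rewrite /cut gt_min [((t + h) / 2 < h)%R]midf_lt// orbT.
    by apply: (lt_le_trans ls); apply: decr_rearr_nonincreasing; rewrite ge_min lexx.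
  exists (t + 1)%R; first by rewrite ltrDl.
  by apply: (lt_le_trans lu); exact: cut_ge0.
- move=> t t0 _; rewrite (integral0_cut u h0 (ltW t0)) (integral0_cut x h0 (ltW t0)).
  by apply: prec_integral => //; rewrite lt_min t0.
Qed.

(** Before [h], [f] is at most [u^*(h) <= u^**(h) <= x^**(h)], the height of the plateau; from [h]
    on, the plateau has the primitive of [x^*], which dominates that of [u^*]. *)
Lemma norm_min_prec h x u : alpha = +oo -> (0 < h)%R -> E x -> E u ->
  E (plateau (max_fun alpha x h) h (rearr x)) -> hlp_prec alpha u x ->
  let f t := mine (rearr u t) (rearr u h) in
  E f /\ (nrm f <= 2 * nrm (plateau (max_fun alpha x h) h (rearr x)))%R.
Proof.
move=> ay h0 Ex Eu Ep ux f.
have f_ni : {homo f : s t / (s <= t)%R >-> t <= s}.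
  move=> s t st; rewrite /f le_min !ge_min lexx orbT andbT.
  by rewrite decr_rearr_nonincreasing.
have f_ge0 t : 0 <= f t by rewrite le_min !decr_rearr_ge0.
have p_ge0 t : 0 <= plateau (max_fun alpha x h) h (rearr x) t.
  by apply: plateau_ge0; exact: max_fun_ge0.
apply: (norm_le_of_integral_le halpha hE hF Ep) => //.
- by apply: plateau_ni; exact: decr_rearr_le_max_fun.
- move=> t l; rewrite {1}/f lt_min => /andP[lu lh].
  have [s ts ls] := decr_rearr_right_continuous (bfs_L0 hB Eu) lu.
  by exists s => //; rewrite /f lt_min ls.
- move=> t t0 _; have [th|ht] := ltP t h.
    apply: ge0_le_integral => //.
    + exact: (measurable_funTS (nonincreasing_emeasurable f_ni)).
    + have p_ni := plateau_ni (decr_rearr_le_max_fun x h0).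
      exact: (measurable_funTS (nonincreasing_emeasurable p_ni)).
    + move=> s; rewrite /= in_itv/= => /andP[_ st].
      rewrite /plateau (le_lt_trans st th) /f ge_min; apply/orP; right.
      apply: le_trans (decr_rearr_le_max_fun u h0) _.
      by have [_ _ uxh] := ux; exact: uxh.
  rewrite integral0_plateau//; apply: le_trans (prec_integral ux t0).
  apply: ge0_le_integral => //.
  + exact: (measurable_funTS (nonincreasing_emeasurable f_ni)).
  + exact: (measurable_funTS (measurable_decr_rearr alpha u)).
  + by move=> s _; rewrite /f ge_min lexx.
Qed.

Lemma order_continuity_K_order_continuity x :
  order_continuity_point alpha E nrm x ->
  (alpha = +oo -> (phi s)%:E * max_fun alpha x s @[s --> +oo%R] --> (0 : \bar R)) ->
  (alpha = +oo -> decr_rearr_infty alpha x = 0) ->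
  K_order_continuity_point alpha E nrm x.
Proof.
move=> ocx phix xinf; have Ex := ocx.1; split => // u Eu ux u0.
apply/cvgrPdist_le => e e0.
(* Head, middle and tail will each cost at most [e / 5]; the further halving pays for the factor 2
   of [norm_le_of_integral_le]. *)
have e5 : (0 < e / 5)%R by rewrite divr_gt0.
have e10 : (0 < e / 5 / 2)%R by rewrite divr_gt0.
have [d [d0 da] [Ec nc]] := norm_cut_small ocx e10.
have [T [T0 Ta] tail] : exists2 T, (0 < T)%R /\ T%:E <= alpha & forall n, exists f,
    [/\ E f, (nrm f <= e / 5)%R, forall t, 0 <= f t &
      forall t, base alpha t -> (T <= t)%R -> rearr (u n) t <= f t].
  (* When [alpha = 1], the choice [T = 1] leaves no point of the base in the tail, and 0 bounds
     it. *)
  case: halpha => ay.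
    exists 1%R; first by rewrite ay.
    move=> n; exists (cst 0); split => //; first exact: (bfs_zero hB).
      have := bfs_norm_scale hB 0%R Ex.
      rewrite (_ : (fun _ => _) = cst 0); last by apply/funext => t; rewrite mul0e.
      by move=> ->; rewrite normr0 mul0r ltW.
    by move=> t [_]; rewrite ay lte_fin ltNge => /negP t1 /t1.
  have [T T0 [Ep np]] := norm_plateau_small ay ocx (phix ay) (xinf ay) e10.
  exists T; first by rewrite ay leey.
  move=> n; have [Ef nf] := norm_min_prec ay T0 Ex (Eu n) Ep (ux n).
  eexists; split; [exact: Ef| | |].
  - apply: (le_trans nf); rewrite [leRHS](_ : _ = 2 * (e / 5 / 2))%R; last by field.
    by rewrite ler_pM2l.
  - by move=> t; rewrite le_min !decr_rearr_ge0.
  - by move=> t _ Tt; rewrite le_min lexx decr_rearr_nonincreasing.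
(* The a.e. convergence is used at a single point [t < d]; monotonicity makes [u_n^*] uniformly
   small from [d] on. *)
have ud : forall c, (0 < c)%R -> \forall n \near \oo, rearr (u n) d <= c%:E.
  move=> c c0; have [t /andP[t0 td] ut] := not_negligible_base d0 da u0.
  have : \forall n \near \oo, rearr (u n) t <= c%:E.
    exact: (ge0_cvge0P (fun n => decr_rearr_ge0 alpha (u n) t)).1 ut c c0.
  apply: filterS => n; apply: le_trans.
  by apply: decr_rearr_nonincreasing; exact: ltW.
have phiT0 := fundamental_fun_gt0 halpha hE T0 Ta.
have c0 : (0 < e / 5 / phi T)%R by rewrite divr_gt0.
apply: filterS (ud _ c0) => n un.
have [f [Ef nf f0 uf]] := tail n.
have [Eu' nu'] := space_decr_rearr halpha hE (Eu n).
have [Ecu ncu] := norm_cut_prec d0 (Eu n) Ec (ux n).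
rewrite sub0r normrN ger0_norm ?(norm_ge0 hE (Eu n))// -nu'.
have Ey : E (fun t => cut d (rearr (u n)) t + f t) := bfs_add hB Ecu Ef.
have [||||_ nu] := norm_le_add_indic (x := rearr (u n)) Ey (ltW c0) T0 Ta.
- by apply: L0_nonincreasing; exact: decr_rearr_nonincreasing.
- exact: decr_rearr_ge0.
- by move=> t; rewrite adde_ge0// cut_ge0.
- move=> t bt t0; have [td|dt] := ltP t d.
    rewrite {1}/cut td -addeA leeDl// adde_ge0// lee_fin; case: ifP => // _.
    exact: ltW.
  have [tT|Tt] := ltP t T.
    apply: (@le_trans _ _ (e / 5 / phi T)%:E).
      by apply: le_trans un; exact: decr_rearr_nonincreasing.
    by rewrite leeDr// adde_ge0// cut_ge0.
  by rewrite adde0; apply: (le_trans (uf _ bt Tt)); rewrite leeDr// cut_ge0.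
apply: (le_trans nu); rewrite divfK ?gt_eqF//.
have := bfs_norm_triangle hB Ecu Ef.
set A := nrm _; set B := nrm _ in ncu *; move: nc nf ncu; set C := nrm _; set D := nrm f.
by move=> *; lra.
Qed.

End order_continuity_implies_K_order_continuity.

Theorem theorem4p8 (R : realType) (alpha : \bar R)
    (halpha : alpha = 1%:E \/ alpha = +oo)
    (E : set (R -> \bar R)) (nrm : (R -> \bar R) -> R)
    (hE : symmetric_space alpha E nrm)
    (hF : fatou_property alpha E nrm)
    (x : R -> \bar R) (hx : E x) :
  (order_continuity_point alpha E nrm x /\
   (alpha = +oo ->
    (fundamental_fun nrm s)%:E * max_fun alpha x s @[s --> +oo%R]
      --> (0 : \bar R)))
  <->
  (K_order_continuity_point alpha E nrm x /\
   (alpha = +oo -> decr_rearr_infty alpha x = 0)).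
Proof.
split=> [[ocx phix]|[kocx xinf]].
  have xinf (ay : alpha = +oo) : decr_rearr_infty alpha x = 0.
    exact: (decr_rearr_infty_of_maximal halpha hE ay (phix ay)).
  split => //; exact: (order_continuity_K_order_continuity halpha hE hF).
split; first exact: (K_order_continuity_order_continuity halpha hE).
by move=> ay; exact: (K_order_continuity_maximal halpha hE ay kocx (xinf ay)).
Qed.
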